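(* Every connected minor of the half grid $\mathbb{N}\square\mathbb{Z}$ is $\preceq$-ubiquitous.
   Context: The half grid $\mathbb{N}\square\mathbb{Z}$ has vertex set $\mathbb{N}\times\mathbb{Z}$, two vertices being adjacent iff they differ in exactly one coordinate and the difference there is one. $\preceq$ denotes the minor relation and $\alpha G$ the disjoint union of $\alpha$ copies of $G$. A graph $G$ is $\preceq$-ubiquitous if for every graph $\Gamma$ (possibly infinite) with $nG \preceq \Gamma$ for all $n \in \mathbb{N}$ one also has $\aleph_0 G \preceq \Gamma$. *)

(* Defs.v *)
From mathcomp Require Import all_boot ssralg ssrnum ssrint.
From mathcomp Require Import classical_sets.
From Stdlib Require Import Relation_Operators.

Set Implicit Arguments.
Unset Strict Implicit.
Unset Printing Implicit Defensive.

Local Open Scope classical_set_scope.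

(* Simple graphs on an arbitrary, possibly infinite, vertex type. *)
Record graph := Graph {
  vertex :> Type;
  adj : vertex -> vertex -> Prop;
  adj_sym : forall x y, adj x y -> adj y x;
  adj_irrefl : forall x, ~ adj x x
}.

(* [A] is nonempty and induces a connected subgraph: any two vertices of [A]
   are joined by a finite walk all of whose vertices lie in [A]. *)
Definition connected_set (G : graph) (A : set G) : Prop :=
  A !=set0 /\
  forall x y, A x -> A y ->
    clos_refl_trans G (fun u v => [/\ A u, A v & adj u v]) x y.

Definition connected_graph (G : graph) : Prop := connected_set [set: G].

(* [B x] is the branch set of the vertex [x]. Branch sets may be infinite. *)
Definition minor (G H : graph) : Prop :=
  exists B : G -> set H,
    [/\ forall x, connected_set (B x),
        trivIset [set: G] B
      & forall x y, adj x y -> exists u v, [/\ B x u, B y v & adj u v]].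

Section Copies.
Variables (I : Type) (G : graph).

Definition copies_adj (p q : I * G) : Prop := p.1 = q.1 /\ adj p.2 q.2.

Lemma copies_adj_sym p q : copies_adj p q -> copies_adj q p.
Proof. by case=> e /adj_sym. Qed.

Lemma copies_adj_irrefl p : ~ copies_adj p p.
Proof. by case=> _ /adj_irrefl. Qed.

(* The disjoint union of copies of [G], one for each element of [I]. *)
Definition copies : graph := Graph copies_adj_sym copies_adj_irrefl.

End Copies.

Definition ubiquitous (G : graph) : Prop :=
  forall Gamma : graph,
    (forall n : nat, minor (copies 'I_n G) Gamma) -> minor (copies nat G) Gamma.

(* [`|m - n|%N] is the (untruncated) distance between [m] and [n], both for
   natural numbers and for integers. *)
Definition half_grid_adj (p q : nat * int) : Prop :=
  (p.1 = q.1 /\ `|p.2 - q.2|%N = 1%N) \/ (p.2 = q.2 /\ `|p.1 - q.1|%N = 1%N).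

Lemma half_grid_adj_sym p q : half_grid_adj p q -> half_grid_adj q p.
Proof. by case=> -[e1 e2]; [left|right]; rewrite distnC. Qed.

Lemma half_grid_adj_irrefl p : ~ half_grid_adj p p.
Proof. by case=> -[_]; rewrite distnn. Qed.

Definition half_grid : graph := Graph half_grid_adj_sym half_grid_adj_irrefl.

(* Main.v *)
(** The members of a family are the connected vertex sets of Gamma containing a model of G.
If no infinite family of disjoint members exists, some vertex set A contains arbitrarily
many disjoint members, but loses this property whenever a member of A is deleted.  Hence
for each finite X all members in A avoiding X lie in one component C(X) of A - X, and
C defines an end which no fewer than n vertices separate from n disjoint members.  Linking
minimum-size separators by Menger's theorem produces infinitely many disjoint rays that
are pairwise inseparable by finite sets (if infinitely many vertices dominate the end, the
rays run through these).

As in Halin's grid theorem, infinitely many of these rays can be arranged in a sequence so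
that consecutive ones are joined by infinitely many disjoint paths avoiding the others: either
infinitely many rays separate two given ones and are therefore linearly ordered (use Ramsey's
theorem), or links between two rays can be kept while further rays are added, and one finds a
tree of rays (use König's lemma).  This gives the quadrant grid on N x N as a minor.  The
quadrant contains the half grid, which contains two disjoint quadrants, and so infinitely
many disjoint models of G. *)

Require Import Defs.
From mathcomp Require Import all_boot ssralg ssrnum ssrint.
From mathcomp Require Import boolp classical_sets zify.
From Stdlib Require Import Relation_Operators.

Set Implicit Arguments.
Unset Strict Implicit.
Unset Printing Implicit Defensive.

Local Open Scope classical_set_scope.

(** * Walks *)

(** Members may be infinite, and one member can meet all members of arbitrarily large disjoint
    families, so deleting members greedily may fail. In a set [A] where deleting a member always
    destroys thickness, this obstacle becomes a tool: a partition of [A - X] that splits no member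
    has a thick side, and a member on the other side could be deleted without loss, so there is
    none.

    Every infinite object is a limit of finite stages obtained by dependent choice. Avoiding
    infinitely many rays becomes two finite demands: avoid the rays already chosen, and choose later
    rays off the vertices already used. *)

Lemma dependent_choice_inv (T : Type) (I : T -> Prop) (R : T -> T -> Prop) (x0 : T) :
  I x0 -> (forall x, I x -> exists2 y, R x y & I y) ->
  exists f : nat -> T, [/\ f 0 = x0, forall n, I (f n) & forall n, R (f n) (f n.+1)].
Proof.
move=> I0 step.
have [|g gP] := @choice _ _ (fun x y => I x -> R x y /\ I y).
  move=> x; case: (pselect (I x)) => [/step[y Rxy Iy]|nI]; first by exists y.
  by exists x.
exists (fun n => iter n g x0); have Iit n : I (iter n g x0) by elim: n => //= n /gP[].
by split=> // n; have /gP[] := Iit n.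
Qed.

Lemma mem_belast_split (T : eqType) (x : T) p z : z \in belast x p ->
  exists p1 y p2, p = p1 ++ y :: p2 /\ last x p1 = z.
Proof.
elim: p x => //= y p IH x; rewrite inE => /orP[/eqP->|/IH[p1 [y' [p2 [-> <-]]]]].
  by exists [::], y, p.
by exists (y :: p1), y', p2.
Qed.

Lemma last_hit (T : eqType) (a : pred T) x r : has a (x :: r) ->
  exists r1 r2, [/\ r = r1 ++ r2, a (last x r1) & ~~ has a r2].
Proof.
elim: r x => [|z r IH] x; first by rewrite /= orbF => ax; exists [::], [::].
case: (boolP (has a (z :: r))) => [/IH[r1 [r2 [-> a1 n2]]] _|n]; first by exists (z :: r1), r2.
by rewrite [has _ _]/= -/(has a (z :: r)) (negPf n) orbF => ax; exists [::], (z :: r).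
Qed.

Section Walks.
Variables (V : eqType) (e : rel V).

(** Walks are explicit lists, so that finitely many of them use a finite set of vertices;
    [joined_clos] and [clos_joined] convert to and from [clos_refl_trans]. *)
Definition joined (P : V -> Prop) x y :=
  exists p, [/\ path e x p, last x p = y & forall z, z \in x :: p -> P z].

Lemma joined_refl (P : V -> Prop) x : P x -> joined P x x.
Proof. by move=> Px; exists [::]; split=> // z; rewrite inE => /eqP->. Qed.

Lemma joined_left P x y : joined P x y -> P x.
Proof. by case=> p [_ _]; apply; rewrite mem_head. Qed.

Lemma joined_right P x y : joined P x y -> P y.
Proof. by case=> p [_ <-]; apply; rewrite mem_last. Qed.

Lemma joined_trans P y x z : joined P x y -> joined P y z -> joined P x z.
Proof.
move=> [p [pp lp Pp]] [q [pq lq Pq]]; exists (p ++ q).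
rewrite cat_path last_cat lp pp; split=> // u.
rewrite -cat_cons mem_cat => /orP[/Pp//|uq].
by apply: Pq; rewrite inE uq orbT.
Qed.

Lemma joined_mono (P Q : V -> Prop) x y : (forall z, P z -> Q z) -> joined P x y -> joined Q x y.
Proof. by move=> PQ [p [pp lp Pp]]; exists p; split=> // z /Pp/PQ. Qed.

Lemma joined_edge (P : V -> Prop) x y : P x -> P y -> e x y -> joined P x y.
Proof.
move=> Px Py exy; exists [:: y]; rewrite /= exy; split=> // z.
by rewrite !inE => /orP[]/eqP->.
Qed.

Lemma joined_sym P x y : symmetric e -> joined P x y -> joined P y x.
Proof.
move=> sym [p [pp lp Pp]]; exists (rev (belast x p)); split.
- by rewrite -lp rev_path; rewrite (eq_path (e' := e)).
- by rewrite -lp; case: (p) => //= z p'; rewrite rev_cons last_rcons.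
- move=> z; rewrite -lp inE mem_rev => /orP[/eqP->|/mem_belast]; last by apply: Pp.
  by apply: Pp; rewrite mem_last.
Qed.

Lemma path_joined (P : V -> Prop) x p z : path e x p -> (forall z, z \in x :: p -> P z) ->
  z \in x :: p -> joined P x z.
Proof.
move=> pp Pp zp; case/splitPl: zp pp Pp => p1 p2 l1.
rewrite cat_path => /andP[pp _] Pp; exists p1; split=> // u up.
by apply: Pp; rewrite -cat_cons mem_cat up.
Qed.

Lemma path_joined_last (P : V -> Prop) x p z : path e x p -> (forall z, z \in x :: p -> P z) ->
  z \in x :: p -> joined P z (last x p).
Proof.
move=> pp Pp zp; case/splitPl: zp pp Pp => p1 p2 l1.
rewrite cat_path last_cat l1 => /andP[_ pp] Pp; exists p2; split=> // u.
rewrite inE => /orP[/eqP->|up]; apply: Pp; rewrite -cat_cons mem_cat ?up ?orbT //.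
by rewrite -l1 mem_last.
Qed.

(** Keep cutting at a later vertex in [P] or an earlier one in [Q]. The result is an infix, so it
    inherits from the walk all avoidance properties and [uniq]. *)
Lemma trim_walk (P Q : V -> Prop) x p : path e x p -> P x -> Q (last x p) ->
  exists x' p', [/\ path e x' p', P x', Q (last x' p'), infix (x' :: p') (x :: p)
    & (forall z, z \in p' -> ~ P z) /\ (forall z, z \in belast x' p' -> ~ Q z)].
Proof.
elim: {p}_.+1 {-2}p x (ltnSn (size p)) => // n IH p x sz pth Px Ql.
case: (pselect (exists2 z, z \in p & P z)) => [[z zp Pz]|nP].
  case/splitPr: zp pth Ql sz => p1 p2.
  rewrite cat_path /= last_cat /= => /and3P[_ _ pth2] Ql sz.
  have [|x' [p' [? ? ? inf ?]]] := IH p2 z _ pth2 Pz Ql; first by rewrite size_cat /= in sz; lia.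
  have inf' : infix (x' :: p') (x :: p1 ++ z :: p2) by rewrite -cat_cons; apply: infix_catl.
  by exists x', p'.
case: (pselect (exists2 z, z \in belast x p & Q z)) => [[z zp Qz]|nQ].
  have [p1 [y [p2 [ep l1]]]] := mem_belast_split zp.
  move: pth sz; rewrite {1 2}ep cat_path size_cat /= => /andP[pth1 _] sz.
  have [||x' [p' [? ? ? inf ?]]] := IH p1 x _ pth1 Px; [lia|by rewrite l1|].
  have inf' : infix (x' :: p') (x :: p) by rewrite ep -cat_cons; apply: infix_catr.
  by exists x', p'.
have inf := infix_refl (x :: p); exists x, p; split=> //.
by split=> z zp Hz; [apply: nP|apply: nQ]; exists z.
Qed.

End Walks.

(** * Menger's theorem *)

Section Menger.
Variables (V : eqType) (e : rel V).

Implicit Types (A B : pred V) (s t : seq (V * seq V)).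

(** The path stops at its first vertex in [B] but may return to [A]. So a linkage meets [B] only in
    its ends, which the augmentation exploits after enlarging [B]. *)
Definition AB_path A B (q : V * seq V) :=
  [&& A q.1, path e q.1 q.2, B (last q.1 q.2) & ~~ has B (belast q.1 q.2)].

Definition verts s := flatten [seq q.1 :: q.2 | q <- s].
Definition ends s := [seq last q.1 q.2 | q <- s].

Arguments verts : simpl never.

Definition linkage A B s := all (AB_path A B) s && uniq (verts s).

Lemma verts_cons q s : verts (q :: s) = (q.1 :: q.2) ++ verts s.
Proof. by []. Qed.

Lemma linkage_perm A B s t : perm_eq s t -> linkage A B s = linkage A B t.
Proof.
move=> st; rewrite /linkage (perm_all _ st); congr andb.
by apply: perm_uniq; apply: perm_flatten; apply: perm_map.
Qed.

Lemma verts_perm s t : perm_eq s t -> perm_eq (verts s) (verts t).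
Proof. by move=> st; apply: perm_flatten; apply: perm_map. Qed.

Lemma ends_sub s : {subset ends s <= verts s}.
Proof.
elim: s => //= q s IH z; rewrite inE verts_cons mem_cat.
by case/orP=> [/eqP->|/IH->]; rewrite ?mem_last ?orbT.
Qed.

Lemma ends_uniq s : uniq (verts s) -> uniq (ends s).
Proof.
elim: s => // q s IH; rewrite verts_cons cat_uniq => /and3P[_ dis us].
rewrite /= IH // andbT; apply/negP => /ends_sub lq; move/negP: dis; apply.
by apply/hasP; exists (last q.1 q.2); rewrite ?mem_last.
Qed.

Lemma linkage_ends A B s z : linkage A B s -> z \in verts s -> B z -> z \in ends s.
Proof.
case/andP=> /allP als _ /flattenP[_ /mapP[q qs ->] zq] Bz.
have /and4P[_ _ _ nb] := als _ qs.
move: zq; rewrite lastI mem_rcons inE => /orP[/eqP->|zb].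
  by apply/mapP; exists q.
by case/hasP: nb; exists z.
Qed.

Lemma tail_split x p w : w \in p -> path e x p -> uniq p ->
  exists q, [/\ path e w q, last w q = last x p, {subset q <= p},
    {subset belast w q <= belast x p} & uniq q /\ w \notin q].
Proof.
case/splitPr => p1 q; rewrite cat_path /= cat_uniq /= => /and3P[_ _ pq] /and4P[_ _ wq uq].
exists q; split=> //; first by rewrite last_cat.
  by move=> z zq; rewrite mem_cat inE zq !orbT.
by move=> z zq; rewrite belast_cat mem_cat inE zq !orbT.
Qed.

(** Since [r] and [r'] lie in [B'], which the old linkage meets only in its ends, they avoid the
    whole linkage as soon as they avoid these ends. *)
Lemma extend_two A B (B' : pred V) y' w' y w r r' t :
  last y'.1 y'.2 = y -> last w'.1 w'.2 = w -> linkage A B' (y' :: w' :: t) -> subpred B B' ->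
  path e y r -> path e w r' -> B (last y r) -> B (last w r') ->
  ~~ has B (belast y r) -> ~~ has B (belast w r') -> all B (ends t) ->
  uniq (r ++ r') -> all B' (r ++ r') ->
  ~~ has (mem [:: y, w & ends t]) (r ++ r') ->
  linkage A B ((y'.1, y'.2 ++ r) :: (w'.1, w'.2 ++ r') :: t).
Proof.
move=> ly lw lk BB' pr pr' Br Br' nr nr' allt urr allrr dis.
have lkE := linkage_ends lk.
case/andP: lk => /and3P[/and4P[Ay py By ny] /and4P[Aw pw Bw nw] tt] uu.
have sub (u : seq V) : ~~ has B' u -> ~~ has B u.
  by apply: contraNN => /hasP[z zu /BB' Bz]; apply/hasP; exists z.
apply/andP; split.
  rewrite /= /AB_path /= Ay Aw !cat_path py pw !last_cat ly lw pr pr' Br Br' /=.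
  rewrite !belast_cat ly lw !has_cat !negb_or (sub _ ny) (sub _ nw) nr nr' /=.
  apply/allP => q qt; have /and4P[-> -> _ nb] := allP tt q qt.
  by rewrite sub // andbT /=; apply: (allP allt); apply/mapP; exists q.
have pe : perm_eq (verts ((y'.1, y'.2 ++ r) :: (w'.1, w'.2 ++ r') :: t))
            (verts [:: y', w' & t] ++ (r ++ r')).
  have -> : verts ((y'.1, y'.2 ++ r) :: (w'.1, w'.2 ++ r') :: t) =
      (y'.1 :: y'.2) ++ r ++ (w'.1 :: w'.2) ++ r' ++ verts t.
    by rewrite !verts_cons /= -!catA.
  rewrite !verts_cons -!catA perm_cat2l.
  move: (w'.1 :: w'.2) (verts t) => W T.
  by apply/permP => c; rewrite !count_cat; clear; lia.
rewrite (perm_uniq pe) cat_uniq uu urr andbT /=.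
apply/hasPn => z zr; apply/negP => /lkE /(_ (allP allrr z zr)) zE.
by move/hasPn: dis => /(_ z zr); rewrite /= -ly -lw zE.
Qed.

(* The augmentation step of Böhme, Göring and Harant: it needs no finiteness of the
   graph, and the induction is on the total length of the given paths. *)
Lemma augment A B k s :
  (forall S : seq V, size S < k -> exists x p, [/\ A x, path e x p, B (last x p)
      & ~~ has (mem S) (x :: p)]) ->
  linkage A B s -> size s < k ->
  exists t, [/\ linkage A B t, size t = (size s).+1 & {subset ends s <= ends t}].
Proof.
elim: {s}_.+1 {-2}s B (ltnSn (size (verts s))) => // n IH s B sz conn lk sk.
have [|x0 [r0 [Ax0 pr0 Br0 nr0]]] := conn (ends s); first by rewrite size_map.
have [x [r [Ax pr Br nb [ur nr]]]] : exists x r, [/\ A x, path e x r, B (last x r),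
     ~~ has B (belast x r) & uniq (x :: r) /\ ~~ has (mem (ends s)) (x :: r)].
  move: Br0; case/shortenP: pr0 => r1 pr1 ur1 sub1 Br1.
  have [x [r [pr Ax Br inf [_ nb]]]] := trim_walk (P := fun z => z = x0) (Q := fun z => B z) pr1 erefl Br1.
  have ur := infix_uniq inf ur1.
  exists x, r; split=> //; [by rewrite Ax|by apply/hasPn => z /nb/negP|].
  split=> //; apply/hasPn => z /(mem_infix inf) zr; move/hasPn: nr0; apply.
  by move: zr; rewrite !inE => /orP[->//|/sub1->]; rewrite orbT.
(* A path that misses the linkage is simply added; otherwise let [y] be its last vertex on the
   linkage. *)
case: (boolP (has (mem (verts s)) (x :: r))) => [hit|nohit]; last first.
  have lk' : linkage A B ((x, r) :: s).
    case/andP: lk => als us; apply/andP; split; first by rewrite /= als /AB_path /= Ax pr Br nb.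
    by rewrite verts_cons cat_uniq ur us andbT /= has_sym.
  by exists ((x, r) :: s); split=> // z zs; rewrite /= inE zs orbT.
have [r1 [r2 [er yv nr2]]] := last_hit hit.
move: yv; set y := last x r1 => yv.
have [q0 q0s yq0] : exists2 q, q \in s & y \in q.1 :: q.2.
  by case/flattenP: yv => _ /mapP[q qs ->] yq; exists q.
have [s0 ps] : exists s0, perm_eq s (q0 :: s0) by exists (rem q0 s); exact: perm_to_rem.
have [a [p1 [p2 [eq0 lp1]]]] : exists a p1 p2, q0 = (a, p1 ++ p2) /\ last a p1 = y.
  case: q0 yq0 {q0s ps} => a p /= yq; case/splitPl: yq => p1 p2 lp1.
  by exists a, p1, p2.
rewrite {q0 q0s yq0}eq0 in ps.
have yr : y \in x :: r by rewrite er -cat_cons mem_cat mem_last.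
have esE : perm_eq (ends s) (last y p2 :: ends s0).
  by rewrite (perm_trans (perm_map _ ps)) //= last_cat lp1.
have vsE : verts s =i (a :: p1) ++ p2 ++ verts s0.
  by move=> z; rewrite (perm_mem (verts_perm ps)) verts_cons /= -catA.
have lyq : last y p2 != y.
  apply: contraNneq nr => ly; apply/hasP; exists y => //=.
  by rewrite (perm_mem esE) ly mem_head.
have [qAB als0 us] : [/\ AB_path A B (a, p1 ++ p2), all (AB_path A B) s0
    & uniq (verts ((a, p1 ++ p2) :: s0))].
  by move: lk; rewrite (linkage_perm _ _ ps) => /andP[/andP[]].
move: qAB; rewrite /AB_path /= cat_path last_cat belast_cat has_cat lp1 negb_or.
move=> /and4P[Aa /andP[pp1 pp2] Bp2 /andP[nbp1 nbp2]].
have us' : uniq (belast a p1 ++ (y :: p2) ++ verts s0).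
  have : uniq ((a :: p1) ++ p2 ++ verts s0) by move: us; rewrite verts_cons /= -catA.
  by rewrite lastI lp1 cat_rcons.
have [D1 D2 D4] : [/\ forall z, z \in belast a p1 -> z \notin y :: p2,
   forall z, z \in verts s0 -> z \notin y :: p2 & uniq (y :: p2)].
  move: us'; rewrite cat_uniq => /and3P[_ /hasPn d1]; rewrite cat_uniq => /and3P[u /hasPn d2 _].
  split=> // z zz.
  by apply/negP => zy; have := d1 z; rewrite mem_cat zy /= zz => /(_ isT).
have D3 z : z \in r2 -> z \notin (a :: p1) ++ p2 ++ verts s0.
  by rewrite -vsE => zr2; move/hasPn: nr2; apply.
have yB : ~~ B y.
  case: (p2) lyq nbp2 => [|z p2' _]; first by rewrite eqxx.
  by rewrite /= negb_or => /andP[].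
move: pr Br nb ur; rewrite er cat_path last_cat belast_cat has_cat negb_or -/y -cat_cons.
move=> /andP[pr1 pr2] Br2 /andP[_ nbr2]; rewrite cat_uniq => /and3P[ur1 dr ur2].
have yr2 : y \notin r2 by apply: contraNN dr => yr2; apply/hasP; exists y; rewrite ?mem_last.
(* The linkage path through [y] is cut at [y]; its rest [p2] and the rest [r2] of the new path join
   the target. As [p2] is nonempty, the cut linkage is shorter and the induction hypothesis
   applies. *)
pose B' := [pred z | [|| B z, z \in y :: p2 | z \in r2]].
have BB' : subpred B B' by move=> z; rewrite /= => ->.
have lk1 : linkage A B' ((a, p1) :: s0).
  apply/andP; split; last first.
    have : uniq ((a :: p1) ++ p2 ++ verts s0) by move: us; rewrite verts_cons /= -catA.
    by apply: subseq_uniq; apply: cat_subseq => //; apply: suffix_subseq.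
  apply/andP; split.
    rewrite /AB_path /= Aa pp1 lp1 inE eqxx /= orbT /=.
    apply/hasPn => z zp; rewrite /= (negPf (hasPn nbp1 z zp)) (negPf (D1 z zp)) /=.
    by apply/negP => /D3; rewrite mem_cat (mem_belast zp).
  apply/allP => q qs0; have /and4P[Aq pq Bq nq] := allP als0 q qs0.
  rewrite /AB_path Aq pq BB' //=; apply/hasPn => z zq.
  have zv : z \in verts s0.
    by apply/flattenP; exists (q.1 :: q.2); [apply/mapP; exists q|apply: mem_belast].
  rewrite /= (negPf (hasPn nq z zq)) (negPf (D2 z zv)) /=.
  by apply/negP => /D3; rewrite !mem_cat zv !orbT.
have size_s : size s = (size s0).+1 by rewrite (perm_size ps).
have [||//||t [lkt szt subt]] := IH ((a, p1) :: s0) B'.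
- have p2gt0 : 0 < size p2 by case: (p2) lyq => //=; rewrite eqxx.
  move: sz; rewrite (perm_size (verts_perm ps)) !verts_cons !size_cat /= size_cat ltnS.
  by apply: leq_trans; rewrite !addSn ltnS addnAC -[ltnLHS]addn0 ltn_add2l.
- by move=> S /conn[x1 [p [? ? Bl ?]]]; exists x1, p; split=> //; exact: BB'.
- by rewrite /= -size_s.
have endst z : z \in verts t -> B' z -> z \in ends t by apply: linkage_ends lkt.
have uet : uniq (ends t) by case/andP: lkt => _ /ends_uniq.
have [Qy Qyt lQy] : exists2 q, q \in t & last q.1 q.2 = y.
  have /subt/mapP[q qt ->] : y \in ends ((a, p1) :: s0) by rewrite /= lp1 mem_head.
  by exists q.
have pt1 := perm_to_rem Qyt; set t1 := rem Qy t in pt1.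
have pe1 : perm_eq (ends t) (y :: ends t1) by rewrite (perm_trans (perm_map _ pt1)) //= lQy.
have es0 z : z \in ends s0 -> z \notin y :: p2 by move/ends_sub/D2.
(* The augmented linkage has exactly one end [w] besides [y] and the ends of [s0]. *)
have /hasP[w wt1 ws0] : has [pred z | z \notin ends s0] (ends t1).
  apply: contraT => /hasPn /= sub.
  have ut1 : uniq (ends t1) by move: uet; rewrite (perm_uniq pe1) /= => /andP[].
  have /(uniq_leq_size ut1) : {subset ends t1 <= ends s0} by move=> z /sub /negbNE.
  have := perm_size pt1; rewrite szt /= !size_map => -[<-].
  by rewrite ltnn.
have [Qw Qwt lQw] : exists2 q, q \in t1 & last q.1 q.2 = w.
  by case/mapP: wt1 => q qt ->; exists q.
have pt2 := perm_to_rem Qwt; set t2 := rem Qw t1 in pt2.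
have pe2 : perm_eq (ends t1) (w :: ends t2) by rewrite (perm_trans (perm_map _ pt2)) //= lQw.
have pt : perm_eq t [:: Qy, Qw & t2] by rewrite (perm_trans pt1) // perm_cons.
have pe : perm_eq (ends t) [:: y, w & ends t2] by rewrite (perm_trans pe1) // perm_cons.
have [yNw yNt2 wNt2 ut2] : [/\ y != w, y \notin ends t2, w \notin ends t2 & uniq (ends t2)].
  by move: uet; rewrite (perm_uniq pe) /= inE negb_or => /and3P[/andP[]].
have sub2 : {subset ends s0 <= ends t2}.
  move=> z zs0; have : z \in ends t by apply: subt; rewrite /= inE zs0 orbT.
  rewrite (perm_mem pe) !inE => /or3P[/eqP zy|/eqP zw|//].
    by have := es0 z zs0; rewrite zy mem_head.
  by rewrite -zw /= zs0 in ws0.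
have eqt2 : ends t2 =i ends s0.
  have us0 : uniq (ends s0).
    by apply: ends_uniq; move: us'; rewrite !cat_uniq => /and3P[_ _ /and3P[]].
  have [|_ E] := uniq_min_size us0 sub2; last by move=> z; rewrite E.
  by have := perm_size pt; rewrite szt /= !size_map => -[<-].
have Bt2 : all B (ends t2).
  apply/allP => z; rewrite eqt2 => /mapP[q qs0 ->].
  by have /and4P[] := allP als0 q qs0.
have finish q1 q2 : linkage A B [:: q1, q2 & t2] ->
    last y p2 \in [:: last q1.1 q1.2; last q2.1 q2.2] -> exists t,
    [/\ linkage A B t, size t = (size s).+1 & {subset ends s <= ends t}].
  move=> lkz lz; exists [:: q1, q2 & t2]; split=> //.
    by rewrite size_s; have := perm_size pt; rewrite szt /= => -[->].
  move=> v; rewrite (perm_mem esE) inE -eqt2 => vE.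
  have -> : ends [:: q1, q2 & t2] = [:: last q1.1 q1.2; last q2.1 q2.2] ++ ends t2 by [].
  by rewrite mem_cat; case/orP: vE => [/eqP->|->]; rewrite ?lz ?orbT.
rewrite (linkage_perm _ _ pt) in lkt.
have ext := extend_two lQy lQw lkt BB'.
have disj u : (forall z, z \in u -> [/\ z != y, z != w & z \notin ends s0]) ->
    ~~ has (mem [:: y, w & ends t2]) u.
  move=> H; apply/hasPn => z /H[zy zw zs].
  by rewrite /= !inE !negb_or zy zw eqt2.
have [p2y r2y] : (forall z, z \in p2 -> z != y) /\ (forall z, z \in r2 -> z != y).
  split=> z zz; apply: contraNneq yr2 => zy; last by rewrite -zy.
  by move: D4; rewrite /= -zy zz.
have [p2s r2s] : (forall z, z \in p2 -> z \notin ends s0) /\ (forall z, z \in r2 -> z \notin ends s0).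
  split=> z zz; first by apply/negP => /es0; rewrite inE zz orbT.
  by apply/negP => /ends_sub zs; have := D3 z zz; rewrite !mem_cat zs !orbT.
have up2 : uniq p2 by move: D4; rewrite cons_uniq => /andP[].
have dpr z : z \in r2 -> z \notin p2 by move/D3; rewrite !mem_cat !negb_or => /and3P[].
have allB' u : {subset u <= p2 ++ r2} -> all B' u.
  move=> H; apply/allP => z /H; rewrite mem_cat /= !inE => /orP[]->; by rewrite !orbT.
(* If [w] is on [p2], its path follows [p2] and the one ending in [y] takes [r2]. Otherwise the path
   ending in [y] takes [p2], and that of [w] follows [r2] or is already in [B]. Either way the end
   of [p2] stays an end. *)
have : w \in p2 \/ w \in r2 \/ B w.
  have : B' w by have [] := andP lkt => /and3P[_ /and4P[_ _]]; rewrite lQw.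
  by rewrite /= inE eq_sym (negPf yNw) /= => /or3P[]; auto.
have sub_has (u v : seq V) : {subset u <= v} -> ~~ has B v -> ~~ has B u.
  by move=> uv /hasPn H; apply/hasPn => z /uv /H.
case: (boolP (w \in p2)) => [wp2 _|wp2].
  have [q [pq lq sq sbq [uq wq]]] := tail_split wp2 pp2 up2.
  have q2 z : z \in r2 -> z \notin q by move=> /dpr; apply: contraNN => /sq.
  apply: (@finish (Qy.1, Qy.2 ++ r2) (Qw.1, Qw.2 ++ q)); last first.
    by rewrite /= !last_cat lQy lQw lq !inE eqxx orbT.
  apply: ext => //; rewrite ?lq //.
  - exact: sub_has nbp2.
  - by rewrite cat_uniq ur2 uq andbT /=; apply/hasPn => z zq; apply/negP => /q2; rewrite zq.
  - by apply: allB' => z; rewrite !mem_cat => /orP[->|/sq->]; rewrite ?orbT.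
  - apply: disj => z; rewrite mem_cat => /orP[zr|zq].
      by split; [exact: r2y|apply: contraTneq wp2 => <-; apply: dpr|exact: r2s].
    by split; [exact/p2y/sq|apply: contraNneq wq => <-|exact/p2s/sq].
case=> [wp2'|[wr2|Bw]]; first by case/negP: wp2.
  have [q [pq lq sq sbq [uq wq]]] := tail_split wr2 pr2 ur2.
  have q2 z : z \in p2 -> z \notin q by move=> zp; apply/negP => /sq /dpr; rewrite zp.
  apply: (@finish (Qy.1, Qy.2 ++ p2) (Qw.1, Qw.2 ++ q)); last first.
    by rewrite /= !last_cat lQy inE eqxx.
  apply: ext => //; rewrite ?lq //.
  - exact: sub_has nbr2.
  - by rewrite cat_uniq up2 uq andbT /=; apply/hasPn => z zq; apply/negP => /q2; rewrite zq.
  - by apply: allB' => z; rewrite !mem_cat => /orP[->|/sq->]; rewrite ?orbT.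
  - apply: disj => z; rewrite mem_cat => /orP[zp|zq].
      by split; [exact: p2y|apply: contraTneq wr2 => <-; apply/negP => /dpr; rewrite zp|exact: p2s].
    by split; [exact/r2y/sq|apply: contraNneq wq => <-|exact/r2s/sq].
apply: (@finish (Qy.1, Qy.2 ++ p2) (Qw.1, Qw.2 ++ [::])); last first.
  by rewrite /= !last_cat lQy inE eqxx.
apply: ext => //; rewrite ?cats0 //.
  by apply: allB' => z zp; rewrite mem_cat zp.
by apply: disj => z zp; split; [exact: p2y|apply: contraNneq wp2 => <-|exact: p2s].
Qed.

Theorem menger A B k :
  (forall S : seq V, size S < k -> exists x p, [/\ A x, path e x p, B (last x p)
      & ~~ has (mem S) (x :: p)]) ->
  exists2 s, linkage A B s & size s = k.
Proof.
move=> conn.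
elim: {-2}k (leqnn k) => [_|j IH jk]; first by exists [::].
have [s lk sj] := IH (ltnW jk).
have [|t [lkt szt _]] := augment conn lk; first by rewrite sj.
by exists t; rewrite // szt sj.
Qed.

End Menger.

(** * Prolonging systems of disjoint paths *)

Section Linkages.
Variables (V : eqType) (e : rel V).
Implicit Types (s : seq (V * seq V)) (Y : seq V).

Lemma verts_rcons s q : verts (rcons s q) = verts s ++ (q.1 :: q.2).
Proof. by elim: s => [|q' s IH]; rewrite /= !verts_cons ?cats0 // IH catA. Qed.

Lemma ends_rcons s q : ends (rcons s q) = rcons (ends s) (last q.1 q.2).
Proof. by rewrite /ends map_rcons. Qed.

(** Disjoint paths have distinct first vertices, so with as many paths as vertices in [A], each
    vertex of [A] starts exactly one. *)
Lemma linkage_reorder (A B : pred V) t (xs : seq V) : linkage e A B t -> uniq xs ->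
  A =1 mem xs -> size t = size xs ->
  exists f : V -> seq V, linkage e A B [seq (x, f x) | x <- xs].
Proof.
move=> lk uxs Axs szt.
have sub : {subset [seq q.1 | q <- t] <= verts t}.
  by move=> _ /mapP[q qt ->]; apply/flattenP; exists (q.1 :: q.2); rewrite ?mem_head // map_f.
have inj q q' : q \in t -> q' \in t -> q.1 = q'.1 -> q = q'.
  have : uniq (verts t) by case/andP: lk.
  elim: (t) => // q0 t0 IH; rewrite verts_cons cat_uniq => /and3P[_ /hasPn dis ut0].
  have no q1 q2 : q1 \in t0 -> q2 = q0 -> q1.1 = q2.1 -> q1 = q2.
    move=> q1t -> eq1; have : q1.1 \in verts t0.
      by apply/flattenP; exists (q1.1 :: q1.2); rewrite ?mem_head // map_f.
    by move/dis; rewrite eq1 mem_head.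
  rewrite !inE => /orP[/eqP->|qt] /orP[/eqP->|qt'] // eq12.
  - by apply/esym; apply: no.
  - exact: no.
  - exact: IH.
have ut : uniq t.
  have : uniq (verts t) by case/andP: lk.
  elim: (t) => // q0 t0 IH; rewrite verts_cons cat_uniq => /and3P[_ /hasPn dis ut0].
  rewrite /= IH // andbT; apply/negP => q0t.
  have /dis : q0.1 \in verts t0 by apply/flattenP; exists (q0.1 :: q0.2); rewrite ?mem_head // map_f.
  by rewrite mem_head.
have ut1 : uniq [seq q.1 | q <- t] by rewrite map_inj_in_uniq.
have sub1 : {subset [seq q.1 | q <- t] <= xs}.
  move=> _ /mapP[q qt ->]; have /andP[/allP/(_ q qt)/and4P[]] := lk.
  by rewrite Axs.
have [|_ eqx] := uniq_min_size ut1 sub1; first by rewrite size_map szt.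
pose f x := (nth (x, [::]) t (index x [seq q.1 | q <- t])).2.
have fP q : q \in t -> q = (q.1, f q.1).
  move=> qt; have q1 := map_f fst qt.
  have := nth_index q.1 q1; rewrite (nth_map (q.1, [::])); last by rewrite -[ltnRHS](size_map fst) index_mem.
  rewrite /f; set q' := nth _ _ _ => e1.
  suff -> : q' = q by case: (q).
  by apply: inj => //; apply: mem_nth; rewrite -[ltnRHS](size_map fst) index_mem.
exists f; rewrite -(linkage_perm _ _ _ (s := t)) //.
apply: uniq_perm => //; first by rewrite map_inj_uniq // => x y [].
move=> q; apply/idP/mapP => [qt|[x]].
  by exists q.1; [rewrite -eqx map_f|exact: fP].
by rewrite -eqx => /mapP[q' q't ->] ->; rewrite -fP.
Qed.

(** The new one-vertex path goes last, so that the older paths, initial segments of future rays,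
    keep their indices. *)
Definition extend (f : V -> seq V) z s :=
  rcons [seq (q.1, q.2 ++ f (last q.1 q.2)) | q <- s] (z, [::]).

Lemma verts_map_perm (f : V -> seq V) s :
  perm_eq (verts [seq (q.1, q.2 ++ f (last q.1 q.2)) | q <- s])
          (verts s ++ flatten [seq f x | x <- ends s]).
Proof.
elim: s => // q s IH; rewrite map_cons !verts_cons -cat_cons -!catA perm_cat2l.
apply: perm_trans (_ : perm_eq _ (f (last q.1 q.2) ++ (verts s ++ flatten [seq f x | x <- ends s]))) _.
  by rewrite perm_cat2l.
by rewrite perm_catCA.
Qed.

Lemma verts_starts_perm (f : V -> seq V) (xs : seq V) :
  perm_eq (verts [seq (x, f x) | x <- xs]) (xs ++ flatten [seq f x | x <- xs]).
Proof.
elim: xs => //= x xs IH; rewrite verts_cons /= perm_cons.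
apply: perm_trans (_ : perm_eq _ (f x ++ (xs ++ flatten [seq f x | x <- xs]))) _.
  by rewrite perm_cat2l.
by rewrite perm_catCA.
Qed.

End Linkages.

Section Extension.
Variables (V : eqType) (e : rel V).

(** Menger's theorem in the graph without the non-tip vertices of [s]. The last clause matters when
    [Z] separates the old vertices from an end: vertices reached from an old tip without crossing
    [Z] are on the near side. *)
Lemma extend_paths (s : seq (V * seq V)) (Y Z : seq V) :
  all (fun q => path e q.1 q.2) s -> uniq (verts s) -> {subset verts s <= Y} ->
  uniq Z -> size s < size Z -> (forall z, z \in Z -> z \notin Y) ->
  (forall S : seq V, size S < size s -> exists t z, [/\ t \in ends s, z \in Z &
     joined e (fun v => v \notin S ++ [seq v <- verts s | v \notin ends s]) t z]) ->
  exists f z, let s' := extend f z s in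
    [/\ all (fun q => path e q.1 q.2) s', uniq (verts s'),
        forall x, x \in ends s -> f x != [::], {subset ends s' <= Z}
      & forall v, v \in verts s' -> [\/ v \in Y, v \in Z | exists2 t, t \in ends s &
           joined e (fun v => v \notin Z) t v]].
Proof.
move=> ps us sY uZ szZ ZY conn.
set X0 := [seq v <- verts s | v \notin ends s] in conn.
pose e' := [rel x y | [&& e x y, x \notin X0 & y \notin X0]].
have [t lk st] : exists2 t, linkage e' (mem (ends s)) (mem Z) t & size t = size s.
  apply: menger => S /conn[t [z [ts zZ [p [pp lp Sp]]]]].
  exists t, p; split=> //; first last.
  - by apply/hasPn => v /Sp; rewrite mem_cat negb_or => /andP[].
  - by rewrite lp.
  have Xp v : v \in t :: p -> v \notin X0 by move/Sp; rewrite mem_cat negb_or => /andP[].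
  elim: p t pp Xp {ts lp Sp} => //= y p IH t /andP[ety pyp] Xp.
  rewrite ety !Xp ?inE ?eqxx ?orbT //=; apply: IH => // v vp.
  by apply: Xp; rewrite inE vp orbT.
have ue := ends_uniq us.
have [f {}lk] := linkage_reorder lk ue (frefl _) (etrans st (esym (size_map _ _))).
have [als uvt] := andP lk.
rewrite (perm_uniq (verts_starts_perm _ _)) in uvt.
have fP x : x \in ends s -> [/\ path e' x (f x), last x (f x) \in Z & ~~ has (mem Z) (belast x (f x))].
  move=> xs; have /(allP als)/and4P[_ /= ? ? ?] : (x, f x) \in [seq (x, f x) | x <- ends s] by exact: map_f.
  by split.
have subF (x v : V) : x \in ends s -> v \in f x -> v \in flatten [seq f x | x <- ends s].
  by move=> xs vf; apply/flattenP; exists (f x) => //; exact: map_f.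
have fX x v : x \in ends s -> v \in f x -> v \notin X0.
  move=> /fP[+ _ _]; move: (f x) => p; elim: p x => //= y p IH x /andP[/and3P[_ _ yX] pyp].
  by rewrite inE => /orP[/eqP->|/(IH _ pyp)].
have fN x : x \in ends s -> f x != [::].
  move=> xs; have [_ lZ _] := fP x xs; apply: contraTneq lZ => -> /=.
  by apply/negP => /ZY; rewrite sY // ends_sub.
set s1 := [seq (x, f x) | x <- ends s] in lk als.
(* [Z] has more vertices than there are paths, so one is left to start a new path. *)
have [z zZ zN] : exists2 z, z \in Z & z \notin ends s1.
  apply/hasP; apply: contraT => /hasPn zn.
  have : {subset Z <= ends s1} by move=> z /zn /= /negbNE.
  by move/(uniq_leq_size uZ); rewrite /s1 !size_map leqNgt szZ.
have zF : z \notin flatten [seq f x | x <- ends s].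
  apply: contraNN zN => zf; apply: (linkage_ends lk) => //.
  by rewrite (perm_mem (verts_starts_perm _ _)) mem_cat zf orbT.
have FU v : v \in flatten [seq f x | x <- ends s] -> v \notin verts s.
  move=> vF; apply/negP => vs.
  have vX : v \notin X0 by case/flattenP: vF => _ /mapP[x xs ->]; apply: fX.
  have ve : v \in ends s by move: vX; rewrite mem_filter vs andbT negbK.
  by move: uvt; rewrite cat_uniq => /and3P[_ /hasPn/(_ _ vF)]; rewrite /= ve.
have vE : verts (extend f z s) =i verts s ++ flatten [seq f x | x <- ends s] ++ [:: z].
  by move=> v; rewrite /extend verts_rcons catA mem_cat (perm_mem (verts_map_perm _ _)) [in RHS]mem_cat.
exists f, z; split.
- rewrite /extend all_rcons /= all_map; apply/allP => q qs /=.
  have [pf _ _] := fP _ (map_f (fun q => last q.1 q.2) qs).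
  rewrite cat_path (allP ps q qs) /=; apply: sub_path pf => x y; by case/and3P.
- rewrite /extend verts_rcons cat_uniq (perm_uniq (verts_map_perm _ _)) /= orbF andbT.
  rewrite (perm_mem (verts_map_perm _ _)) mem_cat negb_or zF andbT.
  rewrite cat_uniq us /= (contraNN (@sY _) (ZY _ zZ)) andbT.
  move: uvt; rewrite cat_uniq => /and3P[_ _ ->]; rewrite andbT.
  by apply/hasPn => v /FU.
- exact: fN.
- move=> v; rewrite /extend ends_rcons mem_rcons inE => /orP[/eqP->//|/mapP[_ /mapP[q qs ->] ->]].
  rewrite /= last_cat; have [] := fP _ (map_f (fun q => last q.1 q.2) qs); by [].
- move=> v; rewrite vE !mem_cat inE => /or3P[/sY|/flattenP[_ /mapP[x xs ->] vf]|/eqP->].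
  + by constructor 1.
  + have [pf lf nf] := fP x xs; have := fN x xs; case/lastP: (f x) pf lf nf vf => // p l pf lf nf vf _.
    move: vf; rewrite mem_rcons inE => /orP[/eqP->|vp].
      by constructor 2; rewrite last_rcons in lf.
    constructor 3; exists x => //; apply: (path_joined (p := p)); last by rewrite inE vp orbT.
      move: pf; rewrite rcons_path => /andP[pp _]; apply: sub_path pp => a b; by case/and3P.
    by move=> w wp; apply: (hasPn nf); rewrite belast_rcons.
  + by constructor 2.
Qed.

End Extension.

(** * Rays as limits of path systems *)

Section Rays.
Variables (V : eqType) (e : rel V).

(** One walk off every finite [X] is enough to get infinitely many disjoint ones, since walks
    already used may be put into [X]. *)
Record equivalent_rays (R : nat -> nat -> V) : Prop := EquivalentRays {
  rays_inj : forall i j a b, R i a = R j b -> i = j /\ a = b;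
  rays_edge : forall i a, e (R i a) (R i a.+1);
  rays_equiv : forall (X : seq V) i j, exists a b, joined e (fun z => z \notin X) (R i a) (R j b)
}.

Lemma collect_joined (E : seq V) (P : V -> Prop) :
  (forall x y, x \in E -> y \in E -> joined e P x y) ->
  exists L : seq V, forall x y, x \in E -> y \in E -> joined e (fun z => z \in L /\ P z) x y.
Proof.
move=> conn.
have [|g gP] := @choice _ _ (fun (xy : V * V) p => xy.1 \in E -> xy.2 \in E ->
    [/\ path e xy.1 p, last xy.1 p = xy.2 & forall z, z \in xy.1 :: p -> P z]).
  move=> [x y]; case: (pselect (x \in E /\ y \in E)) => [[/conn H /H[p pP]]|n]; first by exists p.
  by exists [::] => xE yE; case: n.
exists (flatten [seq x :: g (x, y) | x <- E, y <- E]) => x y xE yE.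
have [pp lp Pp] := gP (x, y) xE yE; exists (g (x, y)); split=> // z zp; split; last exact: Pp.
by apply/flattenP; exists (x :: g (x, y)) => //; apply/allpairsP; exists (x, y).
Qed.

(** Each vertex of [X] enters the growing sets at most once. So for large [n] a walk in [Y n.+1]
    outside [Y n] avoids [X]. *)
Lemma eventually_avoid (Y : nat -> seq V) (X : seq V) :
  (forall n, {subset Y n <= Y n.+1}) ->
  exists N, forall n, N <= n -> forall x, x \in X -> x \in Y n.+1 -> x \in Y n.
Proof.
move=> Ysub; have Ymono n m : n <= m -> {subset Y n <= Y m}.
  by move/subnKC <-; elim: (m - n) => [|k IH] z; rewrite ?addn0 ?addnS // => /IH/Ysub.
elim: X => [|x X [N NP]]; first by exists 0.
case: (pselect (exists m, x \in Y m)) => [[m xm]|nx].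
  exists (maxn N m) => n; rewrite geq_max => /andP[/NP H mn] y.
  by rewrite inE => /orP[/eqP-> _|/H//]; apply: Ymono xm.
exists N => n /NP H y; rewrite inE => /orP[/eqP-> xy|/H//].
by case: nx; exists n.+1.
Qed.

Definition vlist (s : seq (V * seq V)) (x0 : V) i :=
  (nth (x0, [::]) s i).1 :: (nth (x0, [::]) s i).2.

Lemma vlist_inj s x0 i j v : uniq (verts s) -> i < size s -> j < size s ->
  v \in vlist s x0 i -> v \in vlist s x0 j -> i = j.
Proof.
elim: s i j => // q s IH i j; rewrite verts_cons cat_uniq => /and3P[_ /hasPn dis us].
have sub k : k < size s -> {subset vlist s x0 k <= verts s}.
  move=> ks w wk; apply/flattenP; exists (vlist s x0 k) => //.
  by apply/mapP; exists (nth (x0, [::]) s k); rewrite ?mem_nth.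
case: i j => [|i] [|j] //= ki kj.
- by move=> vq /(sub _ kj)/dis/negP[].
- by move=> /(sub _ ki)/dis/negP vq /vq[].
- by move=> vi vj; congr _.+1; apply: IH.
Qed.

Lemma vlist_uniq s x0 i : uniq (verts s) -> i < size s -> uniq (vlist s x0 i).
Proof.
elim: s i => // q s IH i; rewrite verts_cons cat_uniq => /and3P[uq _ us].
by case: i => [|i] //= ki; apply: IH.
Qed.

(* The paths of [s] are the initial segments built so far, and [Y] collects all vertices
   used up to now, including the connecting walks between the tips. *)
Lemma rays_of_system (x0 : V) (I : seq (V * seq V) -> seq V -> Prop) :
  I [::] [::] ->
  (forall s Y, I s Y -> all (fun q => path e q.1 q.2) s /\ uniq (verts s)) ->
  (forall s Y, I s Y -> exists f z Y', let s' := extend f z s in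
     [/\ I s' Y', forall x, x \in ends s -> f x != [::], {subset Y <= Y'}
       & forall x y, x \in ends s' -> y \in ends s' ->
          joined e (fun v => v \in Y' /\ v \notin Y) x y]) ->
  exists R, equivalent_rays R.
Proof.
move=> I0 IP step.
pose Rel (a b : seq (V * seq V) * seq V) := exists f z, [/\ b.1 = extend f z a.1,
  forall x, x \in ends a.1 -> f x != [::], {subset a.2 <= b.2}
       & forall x y, x \in ends b.1 -> y \in ends b.1 ->
          joined e (fun v => v \in b.2 /\ v \notin a.2) x y].
have [|st [st0 Ist stS]] := @dependent_choice_inv _ (fun a => I a.1 a.2) Rel ([::], [::]) I0.
  move=> [s Y] /= /step[f [z [Y' [? ? ? ?]]]]; exists (extend f z s, Y') => //.
  by exists f, z.
pose s n := (st n).1; pose L n i := vlist (s n) x0 i.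
have szs n : size (s n) = n.
  elim: n => [|n IH]; first by rewrite /s st0.
  have [f [z [E _ _ _]]] := stS n.
  by rewrite /s E /extend size_rcons size_map -/(s n) IH.
have us n : uniq (verts (s n)) by case: (IP _ _ (Ist n)).
have Lext n i : i < n -> exists2 p, p != [::] & L n.+1 i = L n i ++ p.
  move=> ni; have [f [z [E fN _ _]]] := stS n.
  pose q := nth (x0, [::]) (s n) i; exists (f (last q.1 q.2)).
    by apply: fN; apply: (map_f (fun q => last q.1 q.2)); rewrite mem_nth ?szs.
  by rewrite /L /vlist /s E /extend nth_rcons size_map -/(s n) szs ni (nth_map (x0, [::])) ?szs.
have Lpre n m i : i < n -> n <= m -> exists p, L m i = L n i ++ p.
  move=> ni /subnKC <-; elim: (m - n) => [|k [p IH]]; first by exists [::]; rewrite addn0 cats0.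
  have [|p' _ E] := Lext (n + k) i; first by rewrite (leq_trans ni) ?leq_addr.
  by exists (p ++ p'); rewrite addnS E IH catA.
have Lsz n i : i < n -> n - i <= size (L n i).
  elim: n => // n IH; rewrite ltnS leq_eqVlt => /orP[/eqP->|ni]; first by rewrite subSnn.
  have [p pN ->] := Lext n i ni; rewrite (subSn (ltnW ni)) size_cat.
  have p0 : 0 < size p by case: (p) pN.
  by rewrite -addn1; exact: leq_add (IH ni) p0.
(* Every stage lengthens every path, so at stage [(i + a).+1] path [i] has more than [a] vertices
   and its entry at position [a] is final. *)
pose R i a := nth x0 (L (i + a).+1 i) a.
have ltS i a : i < (i + a).+1 by rewrite ltnS leq_addr.
have RE n i a : i < n -> a < size (L n i) -> R i a = nth x0 (L n i) a.
  move=> ni asz; have [p Ep] := Lpre n (maxn n (i + a).+1) i ni (leq_maxl _ _).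
  have [p' Ep'] := Lpre (i + a).+1 (maxn n (i + a).+1) i (ltS i a) (leq_maxr _ _).
  have : nth x0 (L (maxn n (i + a).+1) i) a = nth x0 (L n i) a by rewrite Ep nth_cat asz.
  rewrite Ep' nth_cat ifT //.
  by rewrite (leq_trans _ (Lsz _ _ (ltS i a))) // subSn ?leq_addr // addKn.
have Rsz n i a : i + a < n -> a < size (L n i).
  by move=> h; have := Lsz n i; move: (size _) h; clear; lia.
exists R; split.
- move=> i j a b.
  pose n := (i + a + (j + b)).+1.
  have [ia jb] : i + a < n /\ j + b < n by rewrite /n; clear; lia.
  have [ni nj] : i < n /\ j < n by split; [exact: leq_ltn_trans (leq_addr _ _) ia|exact: leq_ltn_trans (leq_addr _ _) jb].
  rewrite (RE n) ?(RE n j) ?Rsz // => E.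
  have ij : i = j.
    apply: (vlist_inj (us n) (x0 := x0) (v := nth x0 (L n i) a)); rewrite ?szs //.
      by rewrite mem_nth ?Rsz.
    by rewrite E mem_nth ?Rsz.
  split=> //; move: E => /eqP; rewrite -ij in jb *; rewrite nth_uniq ?Rsz //; first by move/eqP.
  by apply: vlist_uniq; rewrite ?szs.
- move=> i a; pose n := (i + a.+1).+1; have ni : i < n := ltS _ _.
  have h : a.+1 < size (L n i) by apply: Rsz.
  rewrite (RE n) ?(RE n i a.+1) //; last exact: ltnW.
  have [/allP ps _] := IP _ _ (Ist n).
  have /ps/(pathP x0) : nth (x0, [::]) (s n) i \in s n by rewrite mem_nth ?szs.
  by apply; rewrite -ltnS.
- move=> X i j.
  have [|N NP] := eventually_avoid (Y := fun n => (st n).2) X.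
    by move=> n; have [? [? []]] := stS n.
  (* The step from stage [n] to [n.+1] joins the tips of paths [i] and [j] through fresh vertices,
     none of which is in [X]. *)
  pose n := maxn N (maxn i j).
  have [ni nj] : i < n.+1 /\ j < n.+1 by rewrite !ltnS !leq_max !leqnn !orbT.
  have [f [z [_ _ _ conn]]] := stS n.
  have tip k : k < n.+1 -> exists2 a, last (nth (x0, [::]) (s n.+1) k).1 (nth (x0, [::]) (s n.+1) k).2 = R k a
      & last (nth (x0, [::]) (s n.+1) k).1 (nth (x0, [::]) (s n.+1) k).2 \in ends (s n.+1).
    move=> nk; exists (size (nth (x0, [::]) (s n.+1) k).2).
      by rewrite (RE n.+1) // (last_nth x0).
    by apply: (map_f (fun q => last q.1 q.2)); rewrite mem_nth ?szs.
  have [a Ea ae] := tip i ni; have [b Eb be] := tip j nj.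
  exists a, b; rewrite -Ea -Eb; apply: joined_mono (conn _ _ ae be).
  move=> v [v1 v0]; apply/negP => vX; move/negP: v0; apply.
  by apply: NP vX v1; rewrite leq_maxl.
Qed.

End Rays.

(** * From an end to rays *)

Section Haven.
Variables (V : eqType) (e : rel V).
Hypothesis sym : symmetric e.

(* [C X] plays the role of the component of the complement of [X] containing the end. *)
Record haven (C : seq V -> V -> Prop) : Prop := Haven {
  haven_notin : forall X z, C X z -> z \notin X;
  haven_step : forall X x y, C X x -> e x y -> y \notin X -> C X y;
  haven_conn : forall X x y, C X x -> C X y -> joined e (fun z => z \notin X) x y;
  haven_mono : forall X Y z, {subset X <= Y} -> C Y z -> C X z;
  haven_ne : forall X, exists z, C X z;
  haven_order : forall n, exists Y : seq V,
    forall Z, (forall y, y \in Y -> ~ C Z y) -> n <= size Z }.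

Variable C : seq V -> V -> Prop.
Hypothesis HC : haven C.

Definition dominating v := forall X, v \notin X -> C X v.

Lemma haven_joined X x y : C X x -> joined e (fun z => z \notin X) x y -> C X y.
Proof.
move=> Cx [p [pp <- Xp]]; elim: p x Cx pp Xp => //= z p IH x Cx /andP[exz pp] Xp.
have Xzp v : v \in z :: p -> v \notin X by move=> vp; apply: Xp; rewrite inE vp orbT.
by apply: IH => //; apply: haven_step HC _ _ _ Cx exz _; apply: Xzp; rewrite mem_head.
Qed.

Lemma haven_back X p x v : path e x p -> C X (last x p) ->
  (forall z, z \in x :: p -> z \notin X) -> v \in x :: p -> C X v.
Proof.
move=> pp Cq Xp vp; apply: haven_joined Cq _; apply: joined_sym => //.
exact: path_joined_last pp Xp vp.
Qed.

Definition spec (s : seq (V * seq V)) (Y : seq V) :=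
  [/\ all (fun q => path e q.1 q.2) s, uniq (verts s) & {subset verts s <= Y}].

Lemma spec_collect s (Y : seq V) f z (s' := extend f z s) :
  all (fun q => path e q.1 q.2) s' -> uniq (verts s') ->
  (forall x y, x \in ends s' -> y \in ends s' -> joined e (fun v => v \notin Y) x y) ->
  exists Y', [/\ spec s' Y', {subset Y <= Y'} &
     forall x y, x \in ends s' -> y \in ends s' -> joined e (fun v => v \in Y' /\ v \notin Y) x y].
Proof.
move=> ps us /collect_joined[L LP]; exists (Y ++ verts s' ++ L); split.
- by split=> // v vs; rewrite !mem_cat vs orbT.
- by move=> v vY; rewrite mem_cat vY.
- move=> x y xs ys; apply: joined_mono (LP x y xs ys) => v [vL vY]; split=> //.
  by rewrite !mem_cat vL !orbT.
Qed.

(** All tips are kept dominating. Fewer vertices than tips miss both a tip and one of the new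
    dominating vertices, and these lie in the same [C X]. *)
Lemma rays_of_many_dominating :
  (forall Y : seq V, exists2 v, dominating v & v \notin Y) -> exists R, equivalent_rays e R.
Proof.
move=> many; have [x0 _ _] := many [::].
apply: (@rays_of_system _ _ x0 (fun s Y => spec s Y /\ forall x, x \in ends s -> dominating x)).
- by split=> //; split.
- by move=> s Y [[]].
move=> s Y [[ps us sY] domS].
have [Z [uZ szZ domZ ZY]] : exists Z : seq V, [/\ uniq Z, size Z = (size s).+1,
    forall z, z \in Z -> dominating z & forall z, z \in Z -> z \notin Y].
  elim: (size s).+1 => [|n [Z [uZ szZ domZ ZY]]]; first by exists [::].
  have [v dv] := many (Y ++ Z); rewrite mem_cat negb_or => /andP[vY vZ].
  exists (v :: Z); split=> //=; [by rewrite vZ|by rewrite szZ| |];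
    by move=> z; rewrite inE => /orP[/eqP->|]; auto.
have ue := ends_uniq us.
have [||f [z [ps' us' fN eZ vE]]] := extend_paths ps us sY uZ _ ZY; first by rewrite szZ.
  move=> S szS.
  have [t ts tS] : exists2 t, t \in ends s & t \notin S.
    apply/hasP; apply: contraT => /hasPn sub.
    have /(uniq_leq_size ue) : {subset ends s <= S} by move=> t /sub/negbNE.
    by rewrite size_map leqNgt szS.
  have [z zZ zS] : exists2 t, t \in Z & t \notin S.
    apply/hasP; apply: contraT => /hasPn sub.
    have /(uniq_leq_size uZ) : {subset Z <= S} by move=> u /sub/negbNE.
    by rewrite szZ leqNgt (ltn_trans szS).
  exists t, z; split=> //; apply: haven_conn HC _ _ _ _ _.
    by apply: domS => //; rewrite mem_cat negb_or tS mem_filter ts.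
  apply: domZ => //; rewrite mem_cat negb_or zS mem_filter negb_and.
  by rewrite (contraNN (@sY _) (ZY _ zZ)) orbT.
have [|Y' [sp YY' lk]] := spec_collect ps' us' (Y := Y).
  by move=> x y /eZ xZ /eZ yZ; apply: haven_conn HC _ _ _ _ _; apply: domZ => //; apply: ZY.
exists f, z, Y'; split=> //; split=> // x /eZ; exact: domZ.
Qed.

(** Invariant: in the graph without the non-tip vertices of the paths, fewer than [size s] vertices
    never cut all tips from the end. It is restored by moving the tips onto a minimum-size
    separator. *)
Lemma rays_of_no_dominating :
  (forall v, exists X, v \notin X /\ ~ C X v) -> exists R, equivalent_rays e R.
Proof.
move=> nodom; have [x0 _] := haven_ne HC [::].
pose rest (s : seq (V * seq V)) := [seq v <- verts s | v \notin ends s].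
apply: (@rays_of_system _ _ x0 (fun s Y => spec s Y /\
   forall S : seq V, size S < size s -> exists2 x : V, x \in ends s & C (S ++ rest s) x)).
- by split.
- by move=> s Y [[]].
move=> s Y [[ps us sY] esc].
have [sep sepP] := @choice _ _ (fun v X => v \notin X /\ ~ C X v) nodom.
have [Yb YbP] := haven_order HC (size s).+1.
(* [Z] will be a smallest set separating [W] from the end. [Yb] makes it larger than [size s]. The
   sets [sep y] keep it off [Y]: a vertex [y] of [Y] in [Z] would reach the end through [C Z], hence
   off [sep y], and so lie in [C (sep y)]. *)
pose W := Y ++ flatten [seq sep y | y <- Y] ++ Yb.
pose separates Z := forall w, w \in W -> ~ C Z w.
have [Z [sepZ minZ]] : exists Z, separates Z /\ forall Z', size Z' < size Z -> ~ separates Z'.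
  have exP : exists n, `[< exists2 Z, separates Z & size Z = n >].
    by exists (size W); apply/asboolP; exists W => // w wW /(haven_notin HC); rewrite wW.
  case: (ex_minnP exP) => n /asboolP[Z sZ <-] min; exists Z; split=> // Z' lt sZ'.
  have := min (size Z'); rewrite leqNgt lt => H; suff: false by []; apply: H.
  by apply/asboolP; exists Z'.
have minW Z' : size Z' < size Z -> exists2 w, w \in W & C Z' w.
  move=> /minZ; apply: contra_notP => H w wW Cw; by apply: H; exists w.
have uZ : uniq Z.
  apply: contraT; rewrite -ltn_size_undup => /minW[w /sepZ nw Cw]; case: nw.
  by apply: haven_mono HC _ _ _ _ Cw => v; rewrite mem_undup.
(* By minimality some walk from [W] to the end meets [Z] only in [y]; after its last visit to [y] it
   stays in [C Z]. *)
have reach y T : y \in Z -> exists2 q, C (Z ++ T) q & joined e (fun v => v = y \/ C Z v) y q.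
  move=> yZ; have [|w wW Cw] := minW (rem y Z).
    by rewrite size_rem //; case: (Z) yZ.
  have [q Cq] := haven_ne HC (Z ++ T); exists q => //.
  have CZq : C Z q by apply: haven_mono HC _ _ _ _ Cq => v vZ; rewrite mem_cat vZ.
  have Cq' : C (rem y Z) q by apply: haven_mono HC _ _ _ _ CZq => v /mem_rem.
  have [p [pp lp Xp]] := haven_conn HC Cw Cq'.
  have notZ v : v \notin rem y Z -> v != y -> v \notin Z.
    by rewrite mem_rem_uniq // !inE => + vy; rewrite vy.
  have hit : has (pred1 y) (w :: p).
    apply: contraT => /hasPn ny; case: (sepZ w wW).
    apply: (haven_back pp); rewrite ?mem_head ?lp // => v vp; apply: notZ; [exact: Xp|exact: ny].
  have [r1 [r2 [ep /eqP ly yr2]]] := last_hit hit.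
  move: pp lp Xp; rewrite ep cat_path last_cat ly => /andP[_ pp] lp Xp.
  exists r2; split=> // v; rewrite inE => /orP[/eqP->|vr2]; first by left.
  right; case/splitPr: vr2 pp lp Xp yr2 {hit ep} => a b.
  rewrite cat_path last_cat /= => /and3P[_ _ pp] lp Xp yr2.
  apply: (haven_back pp); rewrite ?mem_head ?lp // => u ub.
  have uab : u \in a ++ v :: b by rewrite mem_cat ub orbT.
  apply: notZ; first by apply: Xp; rewrite -cat_cons mem_cat uab orbT.
  by move/hasPn: yr2 => /(_ u uab).
have outW v : C Z v -> v \notin W by move=> Cv; apply/negP => /sepZ.
have ZY z : z \in Z -> z \notin Y.
  move=> zZ; apply/negP => zY; have [zX nC] := sepP z.
  have [q Cq jq] := reach z (sep z) zZ; apply: nC.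
  apply: haven_joined (joined_sym sym _).
    by apply: haven_mono HC _ _ _ _ Cq => v vX; rewrite mem_cat vX orbT.
  apply: joined_mono jq => v [->//|/outW]; rewrite !mem_cat !negb_or => /and3P[_ + _].
  apply: contraNN => vX; apply/flattenP; exists (sep z) => //; exact: map_f.
have szZ : size s < size Z by apply: YbP => y yb; apply: sepZ; rewrite !mem_cat yb !orbT.
have YW y : y \in Y -> ~ C Z y by move=> yY; apply: sepZ; rewrite mem_cat yY.
have [|f [z [ps' us' fN eZ vE]]] := extend_paths ps us sY uZ szZ ZY.
  move=> S /esc[x xs Cx].
  have [q Cq] := haven_ne HC ((S ++ rest s) ++ Z).
  have Cq1 : C (S ++ rest s) q by apply: haven_mono HC _ _ _ _ Cq => v vS; rewrite mem_cat vS.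
  have Cq2 : C Z q by apply: haven_mono HC _ _ _ _ Cq => v vS; rewrite mem_cat vS orbT.
  have [p [pp lp Xp]] := haven_conn HC Cx Cq1.
  have /hasP[z zp zZ] : has (mem Z) (x :: p).
    apply: contraT => /hasPn nZ; case: (YW x); first by apply/sY/ends_sub.
    by apply: (haven_back pp); rewrite ?mem_head ?lp.
  by exists x, z; split=> //; apply: path_joined pp Xp zp.
set s' := extend f z s in ps' us' eZ vE.
have vC v : v \in verts s' -> ~ C Z v.
  move=> /vE[/YW//|vZ /(haven_notin HC)|[t ts jt] Cv]; first by rewrite vZ.
  apply: (YW t); first by apply/sY/ends_sub.
  by apply: haven_joined Cv (joined_sym sym jt).
have [|Y' [sp YY' lk]] := spec_collect ps' us' (Y := Y).
  have out x : x \in ends s' -> exists2 q, C (Z ++ Y) q & joined e (fun v => v \notin Y) x q.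
    move=> /eZ xZ; have [q Cq jq] := reach x Y xZ; exists q => //.
    apply: joined_mono jq => v [->|Cv]; first exact: ZY.
    by apply/negP => /YW.
  move=> x y /out[q1 C1 j1] /out[q2 C2 j2].
  apply: joined_trans j1 (joined_trans _ (joined_sym sym j2)).
  apply: haven_conn HC _ _ _ _ _;
    [apply: haven_mono HC _ _ _ _ C1|apply: haven_mono HC _ _ _ _ C2] => v vY; by rewrite mem_cat vY orbT.
exists f, z, Y'; split=> //; split=> // S szS.
have ue := ends_uniq us'.
(* This set is smaller than [Z], so some walk from [W] to the end avoids it. The last vertex of this
   walk on [Z] is a tip outside [S], and beyond it the walk runs in [C Z], away from all paths by
   [vC]. *)
have [|w wW Cw] := minW (S ++ [seq v <- Z | v \notin ends s']).
  rewrite size_cat size_filter -(count_predC (mem (ends s')) Z) ltn_add2r.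
  apply: leq_trans szS _; rewrite -size_filter -(size_map (fun q => last q.1 q.2)).
  by apply: uniq_leq_size => // v ve; rewrite mem_filter /= ve eZ.
set Z' := S ++ _ in Cw.
have [q Cq] := haven_ne HC (Z' ++ Z ++ S ++ rest s').
have sub T : {subset T <= Z' ++ Z ++ S ++ rest s'} -> C T q.
  by move=> sub; apply: haven_mono HC _ _ _ sub Cq.
have [|p [pp lp Xp]] := haven_conn HC Cw (sub _ _); first by move=> v vZ; rewrite mem_cat vZ.
have CZq : C Z q by apply: sub => v vZ; rewrite !mem_cat vZ !orbT.
have hit : has (mem Z) (w :: p).
  apply: contraT => /hasPn nZ; case: (sepZ w wW).
  by apply: (haven_back pp); rewrite ?mem_head ?lp.
have [r1 [r2 [ep yZ r2Z]]] := last_hit hit; set y := last w r1 in yZ.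
have Xr2 v : v \in y :: r2 -> v \notin Z'.
  rewrite inE => /orP[/eqP->|vr]; apply: Xp; rewrite ep -cat_cons mem_cat ?mem_last //.
  by rewrite vr orbT.
move: pp lp; rewrite ep cat_path last_cat -/y => /andP[_ pp] lp.
have := Xr2 y (mem_head _ _); rewrite mem_cat negb_or mem_filter negb_and negbK => /andP[yS].
rewrite [y \in Z]yZ orbF => ye.
exists y => //; apply: haven_joined (_ : C _ q) (joined_sym sym _).
  by apply: sub => v vZ; rewrite catA mem_cat vZ orbT.
exists r2; split=> // v; rewrite inE => /orP[/eqP->|vr2].
  by rewrite mem_cat negb_or yS mem_filter ye.
have vZ' : v \notin Z' by apply: Xr2; rewrite inE vr2 orbT.
rewrite mem_cat negb_or; apply/andP; split.
  by apply: contraNN vZ' => vS; rewrite mem_cat vS.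
rewrite mem_filter negb_and; apply/orP; right; apply/negP => /vC; apply.
case/splitPr: vr2 pp lp r2Z {ep Xr2 vZ'} => a b.
rewrite cat_path last_cat /= => /and3P[_ _ pp] lp r2Z.
apply: (haven_back pp); rewrite ?mem_head ?lp // => u ub.
by move/hasPn: r2Z; apply; rewrite mem_cat ub orbT.
Qed.

End Haven.

(** If the dominating vertices lie in a finite set [D], delete [D]: the order of the haven stays
    unbounded because [D] is finite, and no vertex dominates any more. *)
Theorem rays_of_haven (V : eqType) (e : rel V) (C : seq V -> V -> Prop) :
  symmetric e -> haven e C -> exists R, equivalent_rays e R.
Proof.
move=> sym HC.
case: (pselect (forall Y : seq V, exists2 v, dominating C v & v \notin Y)) => [many|few].
  exact: rays_of_many_dominating HC many.
have [D DP] : exists D : seq V, forall v, dominating C v -> v \in D.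
  apply: contra_notP few => H Y; apply: contra_notP H => H; exists Y => v dv.
  by apply: contraT => vY; case: H; exists v.
pose e' := [rel x y | [&& e x y, x \notin D & y \notin D]].
have sym' : symmetric e' by move=> x y /=; rewrite sym (andbC (x \notin D)).
pose C' X := C (X ++ D).
have sub_joined P x y : joined e (fun v => v \notin D /\ P v) x y -> joined e' P x y.
  move=> [p [pp lp Pp]]; exists p; split=> // [|z /Pp[]//].
  elim: p x pp {lp} Pp => //= y' p IH x /andP[exy pp] Pp.
  have [xD _] := Pp x (mem_head _ _).
  have Pp' z : z \in y' :: p -> z \notin D /\ P z by move=> zp; apply: Pp; rewrite inE zp orbT.
  by have [yD _] := Pp' y' (mem_head _ _); rewrite exy xD yD /= IH.
have HC' : haven e' C'.
  split.
  - by move=> X z /(haven_notin HC); rewrite mem_cat negb_or => /andP[].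
  - move=> X x y Cx /and3P[exy _ yD] yX; apply: haven_step HC _ _ _ Cx exy _.
    by rewrite mem_cat negb_or yX.
  - move=> X x y Cx Cy; apply: sub_joined; apply: joined_mono (haven_conn HC Cx Cy) => v.
    by rewrite mem_cat negb_or => /andP[].
  - move=> X Y z XY; apply: haven_mono HC _ _ _ _ => v; rewrite !mem_cat => /orP[/XY->//|->].
    by rewrite orbT.
  - by move=> X; exact: haven_ne HC _.
  - move=> n; have [Y YP] := haven_order HC (n + size D); exists Y => Z /YP.
    by rewrite size_cat leq_add2r.
have [|R [inj edge eqv]] := rays_of_no_dominating sym' HC'.
  move=> v; case: (boolP (v \in D)) => vD.
    by exists [::]; split=> // /(haven_notin HC); rewrite vD.
  have /existsNP[X /not_implyP[vX nC]] : ~ dominating C v by move/DP; rewrite (negPf vD).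
  exists X; split=> // Cv; apply: nC; apply: haven_mono HC _ _ _ _ Cv => u uX.
  by rewrite mem_cat uX.
exists R; split=> // [i a|X i j]; first by have /and3P[] := edge i a.
have [a [b [p [pp lp Xp]]]] := eqv X i j; exists a, b, p; split=> //.
by apply: sub_path pp => x y /and3P[].
Qed.

(** * Thick families of connected sets *)

Section Families.
Variable V : eqType.
Variable member : set V -> Prop.
Implicit Types (A B : set V).

(** [T] is what keeps the process going: thickness in [thick_dichotomy], containing a quadrant in
    [copies_of_quadrant]. *)
Lemma peel (T : set V -> Prop) A0 : T A0 ->
  (forall A, T A -> exists M A', [/\ member M, M `<=` A, A' `<=` A `\` M & T A']) ->
  exists M : nat -> set V, (forall n, member (M n)) /\
    forall m n, m != n -> M m `&` M n = set0.
Proof.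
move=> T0 step.
pose R (a b : set V * set V) := [/\ member b.1, b.1 `<=` a.2 & b.2 `<=` a.2 `\` b.1].
have [|f [_ fT fR]] := @dependent_choice_inv _ (fun a => T a.2) R (set0, A0) T0.
  by move=> [M A] /= /step[M' [A' [? ? ? ?]]]; exists (M', A').
have mono m n : m <= n -> (f n).2 `<=` (f m).2.
  move/subnKC <-; elim: (n - m) => [|k IH]; first by rewrite addn0.
  by rewrite addnS => v; have [_ _ H] := fR (m + k) => /H[/IH].
have dis m n : m < n -> (f m.+1).1 `&` (f n.+1).1 = set0.
  move=> mn; rewrite -subset0 => v [vm vn]; have [_ sub _] := fR n.
  have [_ _ /(_ v)] := fR m; case; last by [].
  exact/(mono m.+1 n mn)/sub.
exists (fun n => (f n.+1).1); split=> [n|m n]; first by case: (fR n).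
by rewrite neq_ltn => /orP[/dis//|/dis]; rewrite setIC.
Qed.

Definition disjoint_family n A (M : nat -> set V) :=
  (forall i, i < n -> member (M i) /\ M i `<=` A) /\
  forall i j, i < n -> j < n -> i != j -> M i `&` M j = set0.

Definition thick A := forall n, exists M, disjoint_family n A M.

Lemma thick_sub A B : A `<=` B -> thick A -> thick B.
Proof.
move=> AB tA n; have [M [MA dM]] := tA n; exists M; split=> // i /MA[? MiA].
by split=> //; apply: subset_trans AB.
Qed.

Lemma subfamily N n A B M (b : pred nat) : disjoint_family N A M ->
  n <= count b (iota 0 N) -> (forall i, i < N -> b i -> M i `<=` B) ->
  exists M', disjoint_family n B M'.
Proof.
move=> [MA dM] nb bB; pose I := [seq i <- iota 0 N | b i].
have In i : i < n -> nth 0 I i \in I by move=> ni; rewrite mem_nth // size_filter (leq_trans ni).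
have IP i : i < n -> nth 0 I i < N /\ b (nth 0 I i).
  by move/In; rewrite mem_filter mem_iota => /andP[-> /andP[]].
exists (fun i => M (nth 0 I i)); split=> [i /IP[iN bi]|i j ni nj ij].
  by split; [case: (MA _ iN)|exact: bB].
apply: dM; [by case: (IP i ni)|by case: (IP j nj)|].
by rewrite nth_uniq ?size_filter ?(leq_trans ni) ?(leq_trans nj) ?filter_uniq ?iota_uniq.
Qed.

Lemma size_hitting (I : seq nat) (M : nat -> set V) (Z : seq V) : uniq I ->
  (forall i j, i \in I -> j \in I -> i != j -> M i `&` M j = set0) ->
  (forall i, i \in I -> exists2 z, z \in Z & M i z) -> size I <= size Z.
Proof.
move=> uI dM hit.
have [->//|[z0 [i0 i0I]]] : I = [::] \/ exists z0 : V, exists i, i \in I.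
  case: I {uI dM} hit => [|i I hit]; first by left.
  by right; have [|z _ _] := hit i; [rewrite mem_head|exists z, i; rewrite mem_head].
have [|g gP] := @choice _ _ (fun i z => i \in I -> z \in Z /\ M i z).
  move=> i; case: (boolP (i \in I)) => [/hit[z zZ Mz]|_]; [by exists z|by exists z0].
rewrite -(size_map g); apply: uniq_leq_size.
  rewrite map_inj_in_uniq // => i j iI jI eqg; apply/eqP; apply: contraT => ij.
  have := dM i j iI jI ij; rewrite -subset0 => /(_ (g i)) [].
  by split; [case: (gP i iI)|rewrite eqg; case: (gP j jI)].
by move=> _ /mapP[i iI ->]; case: (gP i iI).
Qed.

(** If [B] does not contain [n0] disjoint members, then among [n0 + n1] disjoint members of [A] at
    least [n1] lie outside [B]. *)
Lemma thick_split A B : thick A ->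
  (forall M, member M -> M `<=` A -> M `<=` B \/ M `<=` A `\` B) -> thick B \/ thick (A `\` B).
Proof.
move=> tA sp; case: (pselect (thick B)) => [|nB]; [by left|right=> n1].
have /existsNP[n0 n0B] := nB.
have [M fM] := tA (n0 + n1); pose b i := `[< M i `<=` B >].
have cnt := count_predC b (iota 0 (n0 + n1)); rewrite size_iota in cnt.
have [le|lt] := leqP n0 (count b (iota 0 (n0 + n1))).
  case: n0B; apply: subfamily fM le _ => i _ /asboolP; exact.
apply: (subfamily (b := predC b) fM); first by move: cnt lt; clear; lia.
move=> i iN /= /asboolPn nMB; have [Mm MA] := fM.1 i iN.
by have [] := sp _ Mm MA.
Qed.

(** A vertex of [X] spoils at most one member of a disjoint family. *)
Lemma thick_setD_seq A (X : seq V) : thick A -> thick (A `\` [set` X]).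
Proof.
move=> tA n; have [M fM] := tA (n + size X).
pose b i := ~~ has (fun x => `[< M i x >]) X.
apply: (subfamily (b := b) fM).
  have := count_predC b (iota 0 (n + size X)); rewrite size_iota.
  suff : count (predC b) (iota 0 (n + size X)) <= size X by clear; lia.
  rewrite -size_filter; apply: (@size_hitting _ M); first by rewrite filter_uniq ?iota_uniq.
    move=> i j; rewrite !mem_filter !mem_iota => /andP[_ /= ?] /andP[_ /= ?].
    exact: fM.2.
  by move=> i; rewrite mem_filter /= negbK => /andP[/hasP[x xX /asboolP Mx] _]; exists x.
move=> i iN /hasPn nX v Mv; have [_ MA] := fM.1 i iN; split; first exact: MA.
by move=> /= vX; have /asboolP := nX v vX.
Qed.

End Families.

(** * From a thick family to an end *)

Section ThickToHaven.
Variables (V : eqType) (e : rel V).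
Hypothesis sym : symmetric e.
Variable member : set V -> Prop.
Hypothesis member_ne : forall M, member M -> M !=set0.
Hypothesis member_conn : forall M x y, member M -> M x -> M y -> joined e M x y.

Lemma thick_dichotomy : thick member setT ->
  (exists M : nat -> set V, (forall n, member (M n)) /\
    forall m n, m != n -> M m `&` M n = set0) \/
  (exists A, thick member A /\ forall M, member M -> M `<=` A -> ~ thick member (A `\` M)).
Proof.
move=> tT; case: (pselect (exists A, thick member A /\ forall M, member M -> M `<=` A -> ~ thick member (A `\` M))).
  by right.
move=> nA; left; apply: (peel (T := thick member) tT) => A tA.
have [M /not_implyP[Mm /not_implyP[MA /contrapT tAM]]] : exists M, ~ (member M -> M `<=` A -> ~ thick member (A `\` M)).
  by apply/existsNP => H; apply: nA; exists A.
by exists M, (A `\` M); split=> // v.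
Qed.

Lemma haven_of_thick A (e' := [rel x y | [&& e x y, `[< A x >] & `[< A y >]]]) :
  thick member A -> (forall M, member M -> M `<=` A -> ~ thick member (A `\` M)) ->
  exists C, haven e' C.
Proof.
move=> tA ultra.
have sym' : symmetric e' by move=> x y /=; rewrite sym (andbC (asbool (A x))).
pose C (X : seq V) v := exists M m, [/\ member M, M `<=` A `\` [set` X], M m & joined e' (fun z => z \notin X) m v].
have conn' M x y : member M -> M `<=` A -> M x -> M y -> joined e' M x y.
  move=> Mm MA Mx My; have [p [pp lp Mp]] := member_conn Mm Mx My; exists p; split=> //.
  elim: p x {lp Mx} pp Mp => //= z p IH x /andP[exz pp] Mp.
  have Mp' v : v \in z :: p -> M v by move=> vp; apply: Mp; rewrite inE vp orbT.
  rewrite exz (IH z pp Mp') andbT /=; apply/andP; split; apply/asboolP; apply: MA; first exact/Mp/mem_head.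
  exact/Mp'/mem_head.
have connX M (X : seq V) x y : member M -> M `<=` A `\` [set` X] -> M x -> M y -> joined e' (fun z => z \notin X) x y.
  move=> Mm MAX Mx My; apply: joined_mono (conn' _ _ _ Mm _ Mx My) => [v /MAX[_ /negP]//|v /MAX[]//].
have link M M' (X : seq V) m m' : member M -> member M' -> M `<=` A `\` [set` X] -> M' `<=` A `\` [set` X] ->
    M m -> M' m' -> joined e' (fun z => z \notin X) m m'.
  move=> Mm Mm' MAX MAX' Mx Mx'.
  (* The component [C0] of [m] in [A - X] splits no member, so [C0] or the rest of [A - X] is thick.
     A thick [C0] would survive deleting an unjoined [M'], and a thick rest survives deleting [M],
     both against [ultra]. *)
  pose C0 := [set z | A z /\ joined e' (fun z => z \notin X) m z].
  have [|t0|t0] := @thick_split _ member (A `\` [set` X]) C0 (thick_setD_seq X tA).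
  - move=> N Nm NA; case: (pselect (exists2 z, N z & C0 z)) => [[z Nz [Az Cz]]|nz]; [left|right].
      move=> v Nv; split; first by case: (NA v Nv).
      exact: joined_trans Cz (connX _ _ _ _ Nm NA Nz Nv).
    by move=> v Nv; split; [exact: NA|move=> C0v; apply: nz; exists v].
  - have MA' : M' `<=` A by move=> v /MAX'[].
    apply: contrapT => nj; apply: (ultra M' Mm' MA').
    apply: thick_sub t0 => v [Av Cv]; split=> // Mv'; apply: nj.
    exact: joined_trans Cv (connX _ _ _ _ Mm' MAX' Mv' Mx').
  - have MA : M `<=` A by move=> v /MAX[].
    case: (ultra M Mm MA); apply: thick_sub t0 => v [[Av _] nC]; split=> // Mv; apply: nC.
    by split=> //; apply: connX Mx Mv.
exists C; split.
- by move=> X z [M [m [_ _ _ /joined_right]]].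
- move=> X x y [M [m [Mm MA Mx j]]] exy yX; exists M, m; split=> //.
  have jx := joined_right j; apply: joined_trans j _; exact: joined_edge.
- move=> X x y [M [m [Mm MA Mx j]]] [M' [m' [Mm' MA' Mx' j']]].
  apply: joined_trans (joined_sym sym' j) (joined_trans _ j').
  exact: link Mx Mx'.
- move=> X Y z XY [M [m [Mm MA Mx j]]]; exists M, m; split=> //.
    by move=> v /MA[Av nY]; split=> // /XY.
  by apply: joined_mono j => v; apply: contraNN => /XY.
- move=> X; have [M fM] := thick_setD_seq X tA 1.
  have [Mm MA] := fM.1 0 isT; have [m Mx] := member_ne Mm.
  by exists m, (M 0), m; split=> //; apply: (connX (M 0)) => //.
(* Take one vertex from each of [n] disjoint members. A set cutting all of them from the end meets
   each member, since a member avoiding [Z] lies in [C Z]. *)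
- move=> n; have [M fM] := tA n.
  have [|y yP] := @choice _ _ (fun i y => i < n -> M i y).
    have [M1 fM1] := tA 1; have [x0 _] := member_ne (fM1.1 0 isT).1.
    move=> i; case: (ltnP i n) => ni; last by exists x0.
    by have [x Mx] := member_ne (fM.1 i ni).1; exists x.
  exists [seq y i | i <- iota 0 n] => Z nC; rewrite -(size_iota 0 n).
  apply: (@size_hitting _ _ M); first exact: iota_uniq.
    by move=> i j; rewrite !mem_iota /=; exact: fM.2.
  move=> i; rewrite mem_iota /=.
  move=> ni; apply: contrapT => nZ; apply: (nC (y i)); first by rewrite map_f // mem_iota.
  have [Mm MA] := fM.1 i ni.
  have MAZ : M i `<=` A `\` [set` Z].
    by move=> v Mv; split; [exact: MA|move=> vZ; apply: nZ; exists v].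
  exists (M i), (y i); split; rewrite ?yP //; first exact: yP.
  by apply: connX Mm MAZ _ _; exact: yP.
Qed.

Theorem thick_rays : thick member setT ->
  (exists M : nat -> set V, (forall n, member (M n)) /\
    forall m n, m != n -> M m `&` M n = set0) \/ exists R, equivalent_rays e R.
Proof.
case/thick_dichotomy=> [|[A [tA ultra]]]; [by left|right].
have [C HC] := haven_of_thick tA ultra.
have [|R [inj edge eqv]] := rays_of_haven _ HC.
  by move=> x y /=; rewrite sym (andbC (asbool (A x))).
exists R; split=> // [i a|X i j]; first by have /and3P[] := edge i a.
have [a [b [p [pp lp Xp]]]] := eqv X i j; exists a, b, p; split=> //.
by apply: sub_path pp => x y /and3P[].
Qed.

End ThickToHaven.

(** * Ramsey's theorem and König's lemma *)

Lemma unbounded_enum (P : nat -> Prop) : (forall N, exists2 v, N <= v & P v) ->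
  forall N, exists g : nat -> nat, [/\ forall n, P (g n), forall n, N <= g n & {homo g : m n / m < n}].
Proof.
move=> unb N; have [v Nv Pv] := unb N.
have [|g [_ gP gS]] := @dependent_choice_inv _ (fun v => N <= v /\ P v) (fun a b : nat => a < b) v (conj Nv Pv).
  move=> a [Na _]; have [b ab Pb] := unb a.+1; exists b => //.
  by split=> //; apply: leq_trans Na (ltnW ab).
exists g; split=> [n|n|]; try by case: (gP n).
exact: homo_ltn ltn_trans gS.
Qed.

Lemma ramsey_pairs (c : nat -> nat -> Prop) : exists h : nat -> nat, {homo h : m n / m < n} /\
  ((forall a b, a < b -> c (h a) (h b)) \/ (forall a b, a < b -> ~ c (h a) (h b))).
Proof.
pose unb (J : nat -> Prop) := forall N, exists2 v, N <= v & J v.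
(* A state is a number, a colour, and an unbounded set of larger numbers all paired with it in that
   colour. *)
pose I (st : nat * bool * (nat -> Prop)) :=
  unb st.2 /\ forall y, st.2 y -> st.1.1 < y /\ (st.1.2 <-> c st.1.1 y).
pose Rel (a b : nat * bool * (nat -> Prop)) := a.2 b.1.1 /\ forall y, b.2 y -> a.2 y.
have split_unb (J : nat -> Prop) x : unb J -> exists t : bool,
    unb (fun y => J y /\ x < y /\ (t <-> c x y)).
  move=> uJ; apply: contrapT => H.
  have [N1 h1] : exists N, forall y, N <= y -> ~ (J y /\ x < y /\ (true <-> c x y)).
    apply: contrapT => n1; apply: H; exists true => // N; apply: contrapT => n2.
    by apply: n1; exists N => y Ny Jy; apply: n2; exists y.
  have [N2 h2] : exists N, forall y, N <= y -> ~ (J y /\ x < y /\ (false <-> c x y)).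
    apply: contrapT => n1; apply: H; exists false => // N; apply: contrapT => n2.
    by apply: n1; exists N => y Ny Jy; apply: n2; exists y.
  have [y] := uJ (maxn x.+1 (maxn N1 N2)); rewrite !geq_max => /and3P[xy N1y N2y] Jy.
  by case: (pselect (c x y)) => cxy; [case: (h1 y N1y)|case: (h2 y N2y)]; do !split.
have [|t0 ut0] := @split_unb (fun=> True) 0; first by move=> N; exists N.
have [||st [_ Ist stS]] := @dependent_choice_inv _ I Rel (0, t0, fun y => True /\ 0 < y /\ (t0 <-> c 0 y)).
- by split=> // y [_].
- move=> [[x t] J] [uJ JP]; have [y _ Jy] := uJ 0.
  have [t' ut'] := split_unb J y uJ.
  exists (y, t', fun z => J z /\ y < z /\ (t' <-> c y z)); last by split=> // z [].
  by split=> // z [].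
have sub m n y : m <= n -> (st n).2 y -> (st m).2 y.
  move/subnKC <-; elim: (n - m) => [|k IH]; first by rewrite addn0.
  by rewrite addnS => H; apply: IH; case: (stS (m + k)) => _; apply.
have inJ m n : m < n -> (st m).2 (st n).1.1.
  by case: n => // n mn; have [H _] := stS n; apply: sub H.
have key m n : m < n -> (st m).1.1 < (st n).1.1 /\ ((st m).1.2 <-> c (st m).1.1 (st n).1.1).
  by move/inJ; case: (Ist m) => _; apply.
have mono g : {homo g : m n / m < n} -> {homo (fun n => (st (g n)).1.1) : m n / m < n}.
  by move=> gm m n /gm /key[].
case: (pselect (forall N, exists2 n, N <= n & (st n).1.2)) => [ut|nt].
  have [g [gt _ gm]] := unbounded_enum ut 0.
  exists (fun n => (st (g n)).1.1); split; first exact: mono.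
  by left=> a b /gm /key[_ <-].
have [N NP] : exists N, forall n, N <= n -> ~~ (st n).1.2.
  apply: contrapT => H; apply: nt => N; apply: contrapT => H'; apply: H; exists N => n Nn.
  by apply/negP => stn; apply: H'; exists n.
exists (fun n => (st (N + n)).1.1); split; first by apply: mono => m n; rewrite ltn_add2l.
right=> a b ab; have /key[_ <-] : N + a < N + b by rewrite ltn_add2l.
by apply/negP/NP/leq_addr.
Qed.

(** [f] is read as the parent map of a tree on [nat] with root [0]. If no vertex has infinitely many
    children, a vertex with infinitely many descendants has a child with infinitely many. *)
Lemma konig_parent (f : nat -> nat) : (forall m, 0 < m -> f m < m) ->
  (exists a, forall N, exists2 m, N <= m & 0 < m /\ f m = a) \/
  (exists g : nat -> nat, forall n, 0 < g n.+1 /\ f (g n.+1) = g n).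
Proof.
move=> fm; case: (pselect (exists a, forall N, exists2 m, N <= m & 0 < m /\ f m = a)) => [|fin].
  by left.
right; have {}fin a : exists N, forall m, 0 < m -> f m = a -> m < N.
  apply: contrapT => H; apply: fin; exists a => N; apply: contrapT => H'; apply: H; exists N => m m0 fma.
  by rewrite ltnNge; apply/negP => Nm; apply: H'; exists m.
pose f0 m := if m is 0 then 0 else f m.
pose desc x y := exists k, iter k f0 y = x.
have descP x y : desc x y -> y = x \/ exists2 z, 0 < z /\ f z = x & desc z y.
  case=> k; elim: k => [yx|k IH]; first by left.
  rewrite iterS; case E: (iter k f0 y) => [|z] /= fz; first by apply: IH; rewrite E.
  by right; exists z.+1 => //; exists k.
pose big x := forall N, exists2 y, N <= y & desc x y.
have big0 : big 0.
  move=> N; exists N => //; elim: N {-2}N (leqnn N) => [|n IH] [|m] //; try by exists 0.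
  move=> mn; have [|k kP] := IH (f0 m.+1); last by exists k.+1; rewrite iterSr.
  by rewrite -ltnS; apply: leq_trans mn; apply: fm.
have step x : big x -> exists2 z, 0 < z /\ f z = x & big z.
  move=> bx; apply: contrapT => nb; have [N NP] := fin x.
  have [B BP] : exists B, forall z, z < N -> f z = x -> 0 < z -> forall y, desc z y -> y < B.
    elim: (N) => [|n [B BP]]; first by exists 0.
    have [B' BP'] : exists B', f n = x -> 0 < n -> forall y, desc n y -> y < B'.
      case: (pselect (f n = x /\ 0 < n)) => [[fnx n0]|no]; last by exists 0 => h1 h2; case: no.
      have /existsNP[B' nB'] : ~ big n by move=> bn; apply: nb; exists n.
      exists B' => _ _ y dy; rewrite ltnNge; apply/negP => By; apply: nB'; by exists y.
    exists (maxn B B') => z; rewrite ltnS leq_eqVlt => /orP[/eqP zn fz z0 y dy|zn fz z0 y dy].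
      by rewrite zn in fz z0 dy *; rewrite leq_max (BP' fz z0 y dy) orbT.
    by rewrite leq_max (BP z zn fz z0 y dy).
  have [y] := bx (maxn B x.+1); rewrite geq_max => /andP[By xy] /descP[yx|[z [z0 fz] dz]].
    by rewrite yx ltnn in xy.
  by have := BP z (NP z z0 fz) fz z0 y dz; rewrite ltnNge By.
have [|g [_ _ gS]] := @dependent_choice_inv _ big (fun x z => 0 < z /\ f z = x) 0 big0.
  by move=> x /step[z ? ?]; exists z.
by exists g.
Qed.

(** * Links between rays *)

Section Links.
Variables (V : eqType) (e : rel V).
Hypothesis sym : symmetric e.
Variable R : nat -> nat -> V.
Hypothesis HR : equivalent_rays e R.

(** [F] restricts the endpoints too, so [i] and [j] are not in [F]. [X] is a separate parameter
    because [pigeonhole] looks for one alternative that works for all [X]. *)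
Definition linked_off (F : nat -> Prop) (X : seq V) i j := exists a b,
  joined e (fun z => z \notin X /\ forall s c, F s -> z <> R s c) (R i a) (R j b).

Definition linked F i j := forall X, linked_off F X i j.

Definition on i z := exists a, z = R i a.

Lemma linked_off_mono (F F' : nat -> Prop) (X X' : seq V) i j :
  (forall s, F' s -> F s) -> {subset X' <= X} -> linked_off F X i j -> linked_off F' X' i j.
Proof.
move=> FF XX [a [b j']]; exists a, b; apply: joined_mono j' => z [zX zF]; split=> [|s c /FF/zF//].
by apply: contraNN zX; exact: XX.
Qed.

Lemma linked_mono (F F' : nat -> Prop) i j : (forall s, F' s -> F s) -> linked F i j -> linked F' i j.
Proof. by move=> FF lk X; apply: linked_off_mono (lk X). Qed.

Lemma linked_sym F i j : linked F i j -> linked F j i.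
Proof. by move=> lk X; have [a [b jn]] := lk X; exists b, a; apply: joined_sym. Qed.

Lemma linked_all i j : linked (fun=> False) i j.
Proof.
move=> X; have [a [b jn]] := rays_equiv HR X i j; exists a, b.
by apply: joined_mono jn.
Qed.

Lemma ray_tail i (X : seq V) : exists N, forall m, N <= m -> R i m \notin X.
Proof.
elim: X => [|x X [N NP]]; first by exists 0.
case: (pselect (on i x)) => [[a xa]|nx].
  exists (maxn N a.+1) => m; rewrite geq_max => /andP[/NP mX am].
  rewrite inE negb_or mX andbT xa; apply/eqP => /(rays_inj HR)[_ ma].
  by rewrite ma ltnn in am.
exists N => m /NP mX; rewrite inE negb_or mX andbT.
by apply/eqP => xm; apply: nx; exists m.
Qed.

Lemma ray_joined_le (P : V -> Prop) i m n : m <= n -> (forall k, m <= k <= n -> P (R i k)) ->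
  joined e P (R i m) (R i n).
Proof.
move/subnKC <-; elim: (n - m) => [|d IH] Pk.
  by rewrite addn0; apply: joined_refl; apply: Pk; rewrite leqnn leq_addr.
rewrite addnS; apply: (@joined_trans _ _ _ (R i (m + d))).
  by apply: IH => k /andP[mk kd]; apply: Pk; rewrite mk addnS (leq_trans kd).
apply: joined_edge; [apply: Pk|apply: Pk|exact: rays_edge HR _ _].
  by rewrite leq_addr addnS leqnSn.
by rewrite addnS leqnn andbT -addnS leq_addr.
Qed.

Lemma ray_joined (P : V -> Prop) i N m n : N <= m -> N <= n -> (forall k, N <= k -> P (R i k)) ->
  joined e P (R i m) (R i n).
Proof.
move=> Nm Nn Pk; case/orP: (leq_total m n) => le; last apply: joined_sym => //;
  by apply: ray_joined_le => // k /andP[mk _]; apply: Pk; apply: leq_trans mk.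
Qed.

(** The links are composed along [R v]; forbidding an initial segment of [R v] moves both
    attachments to a tail that misses [X]. *)
Lemma linked_trans F a v b : ~ F v -> linked F a v -> linked F v b -> linked F a b.
Proof.
move=> Fv l1 l2 X; have [N NP] := ray_tail v X.
have far m : R v m \notin X ++ mkseq (R v) N -> N <= m.
  rewrite mem_cat negb_or => /andP[_ nm]; rewrite leqNgt; apply: contra nm => mN.
  by apply/mapP; exists m; rewrite ?mem_iota.
have [x [m1 j1]] := l1 (X ++ mkseq (R v) N).
have [m2 [y j2]] := l2 (X ++ mkseq (R v) N).
have sub z : z \notin X ++ mkseq (R v) N /\ (forall s c, F s -> z <> R s c) ->
    z \notin X /\ forall s c, F s -> z <> R s c.
  by case; rewrite mem_cat negb_or => /andP[].
exists x, y; apply: joined_trans (joined_mono sub j1) (joined_trans _ (joined_mono sub j2)).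
have [m1X _] := joined_right j1; have [m2X _] := joined_left j2.
apply: (ray_joined (far _ m1X) (far _ m2X)) => k /NP kX; split=> // s c Fs /(rays_inj HR)[vs _].
by rewrite vs in Fv.
Qed.

(** Otherwise each [a] in [G] fails for some finite set, and the union of these sets defeats all of
    [G]. *)
Lemma pigeonhole (T : eqType) (G : seq T) (P : T -> seq V -> Prop) :
  (forall a X X', {subset X' <= X} -> P a X -> P a X') ->
  (forall X, exists2 a, a \in G & P a X) -> exists2 a, a \in G & forall X, P a X.
Proof.
move=> Pmono GP; apply: contrapT => nG.
have [|w wP] := @choice _ _ (fun a X => a \in G -> ~ P a X).
  move=> a; case: (boolP (a \in G)) => aG; last by exists [::].
  have /existsNP[X nP] : ~ forall X, P a X by move=> PX; apply: nG; exists a.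
  by exists X.
have [a aG Pa] := GP (flatten (map w G)); apply: (wP a aG); apply: Pmono Pa => x xw.
by apply/flattenP; exists (w a) => //; exact: map_f.
Qed.

Lemma trim_linked (I J : nat -> Prop) (P : V -> Prop) x y :
  joined e P x y -> (exists2 s, I s & on s x) -> (exists2 s, J s & on s y) ->
  exists i j a b, [/\ I i, J j &
    exists p, [/\ path e (R i a) p, last (R i a) p = R j b,
      forall z, z \in R i a :: p -> P z
      & (forall z s, z \in p -> I s -> ~ on s z) /\
        (forall z s, z \in belast (R i a) p -> J s -> ~ on s z)]].
Proof.
move=> [p [pp lp Pp]] Ix Jy.
have Jl : exists2 s, J s & on s (last x p) by rewrite lp.
have [x' [p' [pp' [i Ii [a xa]] [j Jj [b yb]] inf [nI nJ]]]] :=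
  trim_walk (P := fun z => exists2 s, I s & on s z) (Q := fun z => exists2 s, J s & on s z) pp Ix Jl.
exists i, j, a, b; split=> //; rewrite -xa -yb; exists p'; split=> //.
  by move=> z /(mem_infix inf)/Pp.
by split=> z s zp Is os; [apply: nI zp _|apply: nJ zp _]; exists s.
Qed.

Lemma linked_hit (F : nat -> Prop) i j v : linked F i j ->
  ~ linked (fun s => s = v \/ F s) i j -> linked F i v.
Proof.
move=> lk /existsNP[X nX] Y; have [a [b [p [pp lp Pp]]]] := lk (Y ++ X).
have [z [c zc] zp] : exists2 z, on v z & z \in R i a :: p.
  apply: contrapT => nz; apply: nX; exists a, b, p; split=> // z zp.
  have [zX zF] := Pp z zp; split; first by move: zX; rewrite mem_cat negb_or => /andP[].
  by move=> s c [->|/zF//] zv; apply: nz; exists z => //; exists c.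
exists a, c; rewrite -zc; apply: joined_mono (path_joined pp Pp zp) => u [].
by rewrite mem_cat negb_or => /andP[].
Qed.

(** Cut each walk at its first vertex on [R v] or [R w]; by [pigeonhole] one of the two outcomes is
    available for every [X]. *)
Lemma linked_first (F : nat -> Prop) i v w : linked F i v -> v != w ->
  linked (fun s => s = w \/ F s) i v \/ linked (fun s => s = v \/ F s) i w.
Proof.
move=> lk vw.
suff [[] _ H] : exists2 b : bool, b \in [:: true; false] & forall X,
    if b then linked_off (fun s => s = w \/ F s) X i v else linked_off (fun s => s = v \/ F s) X i w.
- by left.
- by right.
apply: pigeonhole => [[] Y Y' YY|Y]; try exact: linked_off_mono.
have [a [b jz]] := lk Y.
have [||i' [j' [a' [b' [-> vwj [p [pp lp Pp [_ nJ]]]]]]]] :=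
  @trim_linked (fun s => s = i) (fun s => s = v \/ s = w) _ _ _ jz.
- by exists i => //; exists a.
- by exists v; [left|exists b].
have PY u : u \in R i a' :: p -> u \notin Y /\ forall s c, F s -> u <> R s c.
  by move/Pp.
have off s t : s = v \/ s = w -> last (R i a') p = R t b' -> s <> t ->
    forall u c, u \in R i a' :: p -> u <> R s c.
  move=> svw lt st u c; rewrite lastI mem_rcons inE => /orP[/eqP->|ub ucs].
    by rewrite lt => /(rays_inj HR)[ts _]; apply: st.
  by apply: (nJ u s ub svw); exists c.
case: vwj => jE; rewrite jE in lp; [exists true => //|exists false => //]; exists a', b', p; split=> // u up;
  have [uY uF] := PY u up; split=> // s c [->|/uF//].
- by apply: (off w v) => //; [right|move/esym/eqP; apply/negP].
- by apply: (off v w) => //; [left|move/eqP; apply/negP].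
Qed.

Lemma linked_parent (G : seq nat) w : G != [::] -> w \notin G ->
  exists2 a, a \in G & linked (fun s => s \in G /\ s != a) a w.
Proof.
case: G => // g G _ wG; apply: pigeonhole => [a X X' XX|X].
  exact: linked_off_mono.
have [a [b jn]] := linked_all g w X.
have [||i [j [a' [b' [iG -> [p [pp lp Pp [nI _]]]]]]]] :=
  @trim_linked (fun s => s \in g :: G) (fun s => s = w) _ _ _ jn.
- by exists g; rewrite ?mem_head //; exists a.
- by exists w => //; exists b.
exists i => //; exists a', b', p; split=> // z zp; split; first by case: (Pp z zp).
move=> s c [sG si]; move: zp; rewrite inE => /orP[/eqP->|zp zs].
  by move=> /(rays_inj HR)[is_ _]; rewrite is_ eqxx in si.
by apply: (nI z s zp sG); exists c.
Qed.

(** Links may cross the rays strictly between [a] and [b], and avoid the others only up to index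
    [n]; avoiding infinitely many at once is left to [ladder_exists]. *)
Definition chain (u : nat -> nat) := injective u /\ forall a b n, a < b ->
  linked (fun s => exists2 c, c <= n /\ (c < a \/ b < c) & s = u c) (u a) (u b).

Lemma linked_notin F i j : linked F i j -> ~ F i.
Proof.
move=> lk Fi; have [a [b jn]] := lk [::]; have [_ /(_ i a Fi)] := joined_left jn.
exact.
Qed.

Section Separating.
Variables (i j : nat) (S : seq nat).
Hypothesis lij : linked (fun s => s \in S) i j.
Let breaks v := v \notin S /\ ~ linked (fun s => s = v \/ s \in S) i j.

Let linked_i v : breaks v -> linked (fun s => s \in S) i v.
Proof. by case=> _ nb; exact: linked_hit nb. Qed.

Let linked_j v : breaks v -> linked (fun s => s \in S) j v.
Proof.
case=> _ nb; apply: (linked_hit (j := i)); first exact: linked_sym.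
by move/linked_sym.
Qed.

Let separates_between a b c : breaks a -> a != c -> linked (fun s => s = c \/ s \in S) i a ->
  ~ linked (fun s => s = c \/ s \in S) i b -> ~ linked (fun s => s = c \/ s \in S) a b.
Proof.
move=> [aS _] ac ia nib ab; apply: nib; apply: linked_trans ia ab.
by case=> [E|aS']; [rewrite E eqxx in ac|rewrite aS' in aS].
Qed.

(** From [j] one of the two is reached first, say [v] off [w]. With the link from [i] to [v] off [w]
    this links [i] to [j] off [w], although [w] breaks that link. *)
Let order_antisym v w : breaks v -> breaks w -> v != w ->
  linked (fun s => s = w \/ s \in S) i v -> ~ linked (fun s => s = v \/ s \in S) i w.
Proof.
move=> bv bw vw iv iw.
have [jv|jw] := linked_first (linked_j bv) vw.
- by apply: (separates_between bv vw iv bw.2); exact: linked_sym.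
- by apply: (separates_between bw _ iw bv.2); [rewrite eq_sym|exact: linked_sym].
Qed.

(* Each [g n] separates [i] from [j] off [S], so these rays are linearly ordered by the
   order in which a walk from [i] to [j] has to cross them. *)
Lemma chain_of_separating (g : nat -> nat) :
  (forall n, breaks (g n)) -> {homo g : m n / m < n} -> exists u, chain u.
Proof.
move=> bg gm.
have [h [hm col]] := ramsey_pairs (fun m n => linked (fun s => s = g n \/ s \in S) i (g m)).
pose u n := g (h n).
have um : {homo u : m n / m < n} by move=> m n /hm/gm.
have uinj : injective u.
  move=> m n; case: (ltngtP m n) => // /um + E; by rewrite E ltnn.
have une a b : a != b -> u a != u b by apply: contraNneq => /uinj ->.
have bu n : breaks (u n) := bg (h n).
(* By [col] the rays are ordered, upwards or downwards, along the way from [i] to [j], so [u c]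
   separates [u a] from [u b] off [S]. *)
have btw a c b : a < c < b -> ~ linked (fun s => s = u c \/ s \in S) (u a) (u b).
  case/andP=> ac cb; have nac : u a != u c by rewrite une ?neq_ltn ?ac.
  have nbc : u b != u c by rewrite une ?neq_ltn ?cb ?orbT.
  case: col => col.
    apply: separates_between => //; first exact: col.
    apply: order_antisym => //; first by rewrite eq_sym.
    exact: col.
  move/linked_sym; apply: separates_between => //; last exact: col.
  have ncb : u c != u b by rewrite eq_sym.
  by have [/(col _ _ cb)|] := linked_first (linked_i (bu c)) ncb.
have lS a b : linked (fun s => s \in S) (u a) (u b).
  apply: linked_trans (linked_notin lij) (linked_sym _) _; exact: linked_i.
exists u; split=> // a b n ab X.
pose N := maxn n b.
(* [w] gives for each triple a finite set such that walks off it must cross the middle ray. A walk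
   off all these sets, trimmed between the rays up to [a] and those from [b] to [N], starts on
   [u a]: from an earlier ray it would have to cross [u a]. Likewise it ends on [u b]. *)
have [|w wP] := @choice _ _ (fun (t : nat * nat * nat) Y => t.1.1 < t.1.2 < t.2 ->
    ~ linked_off (fun s => s = u t.1.2 \/ s \in S) Y (u t.1.1) (u t.2)).
  case=> [[a' c'] b']; case: (boolP (a' < c' < b')) => [/btw/existsNP[Y nY]|_]; first by exists Y.
  by exists [::].
pose Is := iota 0 N.+1.
pose T := [seq (p, z) | p <- [seq (x, y) | x <- Is, y <- Is], z <- Is].
have TP x y z : x <= N -> y <= N -> z <= N -> (x, y, z) \in T.
  move=> xN yN zN; apply/allpairsP; exists ((x, y), z); split; rewrite ?mem_iota //.
  by apply/allpairsP; exists (x, y); rewrite !mem_iota.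
have [x [y jn]] := lS a b (X ++ flatten (map w T)).
have [||_ [_ [x' [y' [[c1 c1a ->] [c2 /andP[bc2 c2N] ->]]]]]] :=
  @trim_linked (fun s => exists2 c, c <= a & s = u c) (fun s => exists2 c, b <= c <= N & s = u c) _ _ _ jn.
- by exists (u a); [exists a|exists x].
- by exists (u b); [exists b; rewrite ?leqnn ?leq_maxr|exists y].
move=> [p [pp lp Pp [nI nJ]]].
have aN : a <= N by apply: leq_trans (ltnW ab) (leq_maxr _ _).
have bN : b <= N by exact: leq_maxr.
have c1c2 : c1 < c2 by apply: leq_ltn_trans c1a (leq_trans ab bc2).
have offP c : c <= N -> c1 < c < c2 ->
   (forall z, z \in R (u c1) x' :: p -> ~ on (u c) z) -> False.
  move=> cN cc nc; apply: (wP (c1, c, c2) cc); exists x', y', p; split=> // z zp.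
  have [zX zS] := Pp z zp; split; last first.
    by move=> s d [->|/zS//] zd; apply: (nc z zp); exists d.
  apply: contraNN zX => zw; rewrite mem_cat; apply/orP; right; apply/flattenP.
  by exists (w (c1, c, c2)) => //; apply: map_f; apply: TP => //; apply: leq_trans c1a aN.
have offI c : c <= a -> c != c1 -> forall z, z \in R (u c1) x' :: p -> ~ on (u c) z.
  move=> ca cc1 z; rewrite inE => /orP[/eqP-> [d /(rays_inj HR)[/uinj E _]]|zp].
    by rewrite E eqxx in cc1.
  by apply: (nI z _ zp); exists c.
have offJ c : b <= c <= N -> c != c2 -> forall z, z \in R (u c1) x' :: p -> ~ on (u c) z.
  move=> bc cc2 z; rewrite lastI lp mem_rcons inE => /orP[/eqP-> [d /(rays_inj HR)[/uinj E _]]|zp].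
    by rewrite E eqxx in cc2.
  by apply: (nJ z _ zp); exists c.
have c1E : c1 = a.
  apply/eqP; rewrite eqn_leq c1a /= leqNgt; apply/negP => c1lt.
  apply: (offP a aN); first by rewrite c1lt (leq_trans ab).
  by apply: offI; rewrite // neq_ltn c1lt orbT.
have c2E : c2 = b.
  apply/eqP; rewrite eqn_leq bc2 andbT leqNgt; apply/negP => c2lt.
  apply: (offP b bN); first by rewrite c2lt c1E ab.
  by apply: offJ; rewrite ?leqnn // neq_ltn c2lt.
exists x', y'; rewrite -c1E -c2E; exists p; split=> // z zp.
have [zX _] := Pp z zp; split; first by move: zX; rewrite mem_cat negb_or => /andP[].
move=> s d [c [cn cab] ->] zd.
have oz : on (u c) z by exists d.
case: cab => [ca|bc]; [apply: (offI c _ _ z zp oz)|apply: (offJ c _ _ z zp oz)].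
- by rewrite ltnW // -c1E.
- by rewrite neq_ltn ca.
- by rewrite -c2E ltnW //= leq_max cn.
- by rewrite neq_ltn bc orbT.
Qed.

End Separating.

(* The rays chosen so far form a tree whose links survive all later choices; an infinite star
   or a ray of this tree yields the chain. *)
Lemma chain_of_robust :
  (forall i j (S : seq nat), linked (fun s => s \in S) i j ->
     exists N, forall v, N <= v -> linked (fun s => s = v \/ s \in S) i j) ->
  exists u, chain u.
Proof.
move=> robust.
pose but (l : seq nat) (p : nat * nat) := [seq s <- l | (s != p.1) && (s != p.2)].
(* Links between two rays of [l] off the remaining ones must survive when [v] is avoided as well.
   The sums used below merely bound the entries of a list. *)
pose good (l : seq nat) v := (forall x, x \in l -> x < v) /\ forall i j, i \in l -> j \in l ->
  linked (fun s => s \in but l (i, j)) i j -> linked (fun s => s = v \/ s \in but l (i, j)) i j.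
have step (l : seq nat) : exists v, good l v.
  have [N NP] : exists N, forall v, N <= v -> forall p : nat * nat, p \in [seq (x, y) | x <- l, y <- l] ->
     linked (fun s => s \in but l p) p.1 p.2 -> linked (fun s => s = v \/ s \in but l p) p.1 p.2.
    elim: [seq (x, y) | x <- l, y <- l] => [|p ps [N NP]]; first by exists 0.
    case: (pselect (linked (fun s => s \in but l p) p.1 p.2)) => [/robust[N' NP']|nl].
      exists (maxn N N') => v; rewrite geq_max => /andP[/NP NPv /NP' N'P] q.
      by rewrite inE => /orP[/eqP->|/NPv].
    by exists N => v /NP NPv q; rewrite inE => /orP[/eqP->|/NPv].
  exists (maxn N (\sum_(x <- l) x).+1); split=> [x xl|i j il jl].
    rewrite leq_max ltnS; apply/orP; right.
    by rewrite (big_rem x xl) /= leq_addr.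
  apply: (NP _ (leq_maxl _ _) (i, j)); apply/allpairsP; by exists (i, j).
have [|l [l0 _ lS]] := @dependent_choice_inv _ (fun=> True) (fun l l' => exists2 v, l' = v :: l & good l v) [::] I.
  by move=> l _; have [v gv] := step l; exists (v :: l) => //; exists v.
pose v n := head 0 (l n.+1).
have lE n : l n.+1 = v n :: l n /\ good (l n) (v n).
  by rewrite /v; have [w -> gw] := lS n.
have memP n x : x \in l n <-> exists2 c, c < n & x = v c.
  elim: n => [|n IH]; first by rewrite l0; split=> // -[].
  rewrite (lE n).1 inE; split=> [/orP[/eqP->|/IH[c cn ->]]|[c]]; first by exists n.
    by exists c => //; apply: ltnW.
  rewrite ltnS leq_eqVlt => /orP[/eqP-> ->|cn xE]; first by rewrite eqxx.
  by apply/orP; right; apply/IH; exists c.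
have vm : {homo v : m n / m < n} by move=> m n mn; apply: (lE n).2.1; apply/memP; exists m.
have vinj : injective v by move=> m n; case: (ltngtP m n) => // /vm + E; rewrite E ltnn.
pose Q n a b := linked (fun s => exists2 c, c < n & [/\ c != a, c != b & s = v c]) (v a) (v b).
have QS n a b : a < n -> b < n -> Q n a b -> Q n.+1 a b.
  move=> an bn Qn; have [_ H] := (lE n).2.
  have /H H' : v a \in l n by apply/memP; exists a.
  have /H' {}H' : v b \in l n by apply/memP; exists b.
  apply: linked_mono (H' _) => [s [c]|].
    rewrite ltnS leq_eqVlt => /orP[/eqP-> [_ _]|cn [ca cb ->]]; [by left|right].
    rewrite mem_filter /= !(inj_eq vinj) ca cb /=; apply/memP; by exists c.
  apply: linked_mono Qn => s; rewrite mem_filter /= => /andP[/andP[sa sb] /memP[c cn sE]].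
  by exists c => //; split=> //; [apply: contraNneq sa => <-|apply: contraNneq sb => <-]; apply/eqP.
have Qsub n m a b : m <= n -> Q n a b -> Q m a b.
  by move=> mn; apply: linked_mono => s [c cm cP]; exists c => //; apply: leq_trans mn.
(* The parent of ray [k] is an earlier ray linked to it off all other earlier ones; by [QS] this
   link survives all later choices. *)
have [|f fP] := @choice _ _ (fun k a => 0 < k -> a < k /\ Q k.+1 a k).
  case=> [|k]; first by exists 0.
  have [||x /memP[a ak ->] lk] := @linked_parent (l k.+1) (v k.+1).
  - by rewrite (lE k).1.
  - by apply/negP => /(lE k.+1).2.1; rewrite ltnn.
  exists a => _; split=> //; apply: linked_mono lk => s [c ck [ca ck' ->]]; split.
    by apply/memP; exists c => //; rewrite ltn_neqAle ck' -ltnS.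
  by rewrite (inj_eq vinj).
have fQ k n : 0 < k -> Q n (f k) k.
  move=> k0; have [fk Qk] := fP k k0.
  case: (leqP n k.+1) => [|/ltnW/subnKC <-]; first by move/Qsub; apply.
  elim: (n - k.+1) => [|d IH]; rewrite ?addn0 // addnS; apply: QS => //.
    by apply: leq_trans fk _; rewrite addSn ltnW // ltnS leq_addr.
  by rewrite addSn ltnS leq_addr.
have [|[a aP]|[g gP]] := konig_parent (f := f); first by move=> m /fP[].
(* Infinite star: the leaves form the chain, linked through the centre [a], which is not one of
   them. *)
- have [g [gP _ gm]] := unbounded_enum aP 0.
  have ginj : injective g by move=> m n; case: (ltngtP m n) => // /gm + E; rewrite E ltnn.
  have ag n : a != g n.
    have [g0 ga] := gP n; have [+ _] := fP _ g0; rewrite ga; by rewrite ltn_neqAle => /andP[].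
  exists (fun n => v (g n)); split=> [m n /vinj/ginj//|x y n xy].
  pose M := (\sum_(c < n.+1) g c).+1.
  have leaf z : linked (fun s => exists2 c, c <= n /\ c != z & s = v (g c)) (v a) (v (g z)).
    have [gz0 gza] := gP z; have := fQ (g z) M gz0; rewrite gza; apply: linked_mono.
    move=> s [c [cn cz] ->]; exists (g c); last first.
      by split=> //; [rewrite eq_sym|rewrite (inj_eq ginj)].
    rewrite ltnS; have cn' : c < n.+1 by [].
    by rewrite (bigD1 (Ordinal cn')) //= leq_addr.
  apply: (@linked_trans _ _ (v a)).
  - by case=> c _ /vinj E; move: (ag c); rewrite E eqxx.
  - apply: linked_sym; apply: linked_mono (leaf x) => s [c [cn cxy] ->]; exists c => //; split=> //.
    by rewrite neq_ltn; case: cxy => [->//|yc]; rewrite (ltn_trans xy yc) orbT.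
  - apply: linked_mono (leaf y) => s [c [cn cxy] ->]; exists c => //; split=> //.
    by rewrite neq_ltn; case: cxy => [cx|->]; rewrite ?orbT // (ltn_trans cx xy).
(* Infinite path: compose the links along its edges, passing through the rays between [x] and [y],
   as a chain permits. *)
have gm : {homo g : m n / m < n}.
  apply: homo_ltn; first exact: ltn_trans.
  by move=> n; have [g0 fg] := gP n; have [] := fP _ g0; rewrite fg.
have ginj : injective g by move=> m n; case: (ltngtP m n) => // /gm + E; rewrite E ltnn.
exists (fun n => v (g n)); split=> [m n /vinj/ginj//|x y n xy].
pose M := (\sum_(c < n.+1) g c).+1.
have gM c : c <= n -> g c < M.
  by move=> cn; have cn' : c < n.+1 by []; rewrite ltnS (bigD1 (Ordinal cn')) //= leq_addr.
set F := (F in linked F).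
have edge d : x <= d -> d < y -> linked F (v (g d)) (v (g d.+1)).
  move=> xd dy; have [g0 fg] := gP d; have := fQ (g d.+1) M g0; rewrite fg; apply: linked_mono.
  move=> s [c [cn cxy] ->]; exists (g c); first exact: gM.
  by split=> //; rewrite (inj_eq ginj); apply/eqP => E; move: xd dy cxy; rewrite E; clear; lia.
have nF d : x <= d <= y -> ~ F (v (g d)).
  by case/andP=> xd dy [c [_ cxy] /vinj/ginj E]; move: xd dy cxy; rewrite E; clear; lia.
rewrite -(subnKC xy); have : x.+1 + (y - x.+1) <= y by rewrite subnKC.
elim: (y - x.+1) => [_|d IH]; rewrite ?addn0; first exact: edge.
rewrite addnS => dy; apply: linked_trans (IH (ltnW dy)) (edge _ _ dy).
  by apply: nF; rewrite (ltnW dy) addSn -addnS leq_addr.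
by rewrite addSn -addnS leq_addr.
Qed.

Theorem chain_exists : exists u, chain u.
Proof.
case: (pselect (forall i j (S : seq nat), linked (fun s => s \in S) i j ->
     exists N, forall v, N <= v -> linked (fun s => s = v \/ s \in S) i j)); first exact: chain_of_robust.
move=> /existsNP[i /existsNP[j /existsNP[S /not_implyP[lij nN]]]].
have unb N : exists2 v, N <= v & ~ linked (fun s => s = v \/ s \in S) i j.
  apply: contrapT => H; apply: nN; exists N => v Nv; apply: contrapT => nl; apply: H; by exists v.
have [g [gP gN gm]] := unbounded_enum unb (\sum_(x <- S) x).+1.
apply: (chain_of_separating lij _ gm) => n; split=> //.
apply/negP => gS; have := gN n; rewrite ltnNge => /negP; apply.
by rewrite (big_rem _ gS) /= leq_addr.
Qed.

End Links.

(** * Ladders of rays *)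

Section Ladder.
Variables (V : eqType) (e : rel V).
Hypothesis sym : symmetric e.

Lemma rays_reindex (R : nat -> nat -> V) (u : nat -> nat) : injective u ->
  equivalent_rays e R -> equivalent_rays e (fun n => R (u n)).
Proof.
move=> uinj [inj edge eqv]; split=> // i j a b /inj[/uinj -> ->].
by [].
Qed.

Lemma rays_avoid (R : nat -> nat -> V) (X : seq V) : equivalent_rays e R ->
  exists N, forall v, N <= v -> forall z, z \in X -> ~ on R v z.
Proof.
move=> HR; elim: X => [|x X [N NP]]; first by exists 0.
case: (pselect (exists i, on R i x)) => [[i [a xa]]|nx].
  exists (maxn N i.+1) => v; rewrite geq_max => /andP[/NP vX iv] z.
  rewrite inE => /orP[/eqP->|/vX//]; case=> b; rewrite xa => /(rays_inj HR)[iE _].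
  by rewrite iE ltnn in iv.
exists N => v /NP vX z; rewrite inE => /orP[/eqP-> ov|/vX//].
by apply: nx; exists v.
Qed.

Definition ladder (Q : nat -> nat -> V) :=
  forall a, linked e Q (fun c => c != a /\ c != a.+1) a a.+1.

(* A link of the chain avoids finitely many given rays; it avoids the remaining rays of the
   ladder because those are chosen later, off all links used before. *)
Lemma ladder_exists (R : nat -> nat -> V) : equivalent_rays e R ->
  exists2 Q, equivalent_rays e Q & ladder Q.
Proof.
move=> HR0; have [u [uinj ch]] := chain_exists sym HR0.
pose C n := R (u n); have HR : equivalent_rays e C := rays_reindex uinj HR0.
pose F n a b s := s <= n /\ (s < a \/ b < s).
have {}ch a b n X : a < b -> linked_off e C (F n a b) X a b.
  move=> ab; have [x [y jn]] := ch a b n ab X; exists x, y; apply: joined_mono jn => z [zX zF].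
  by split=> // s c [sn sab]; apply: (zF (u s)); exists s.
pose rung (l : seq nat) (X Y : seq V) i j := exists a b, joined e (fun z => [/\ z \in Y, z \notin X
   & forall s, s \in l -> s != i -> s != j -> ~ on C s z]) (C i a) (C j b).
pose consecutive (l : seq nat) i j := [/\ i \in l, j \in l, i < j & forall s, s \in l -> s <= i \/ j <= s].
pose Rel (a b : seq nat * seq V) := exists2 v, b.1 = v :: a.1 &
  [/\ forall x, x \in a.1 -> x < v, {subset a.2 <= b.2}, forall z, z \in b.2 -> ~ on C v z
    & forall i j, consecutive a.1 i j -> rung a.1 a.2 b.2 i j].
have step a : exists2 b, Rel a b & True.
  case: a => l X.
  have [Y YP] : exists Y : seq V, forall p : nat * nat, p \in [seq (x, y) | x <- l, y <- l] ->
      consecutive l p.1 p.2 -> rung l X Y p.1 p.2.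
    elim: [seq (x, y) | x <- l, y <- l] => [|[i j] ps [Y YP]]; first by exists [::].
    case: (pselect (consecutive l i j)) => [[il jl ij lij]|nc]; last first.
      exists Y => q; rewrite inE => /orP[/eqP->|/YP//].
      by move=> c; case: nc.
    have [x [y [p [pp lp Pp]]]] := ch i j (\sum_(s <- l) s) X ij.
    exists (Y ++ C i x :: p) => q; rewrite inE => /orP[/eqP->|/YP YP' /YP'[x' [y' jn]]] /=.
      move=> _; exists x, y, p; split=> // z zp; have [zX zF] := Pp z zp; split=> //.
        by rewrite mem_cat zp orbT.
      move=> s sl si sj [c zc]; apply: (zF s c) zc; split; first by rewrite (big_rem s sl) leq_addr.
      by case: (lij s sl) => h; [left|right]; rewrite ltn_neqAle h ?andbT // eq_sym.
    by exists x', y'; apply: joined_mono jn => z [zY zX zl]; split=> //; rewrite mem_cat zY.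
  have [N NP] := rays_avoid (X ++ Y) HR.
  exists ((maxn N (\sum_(x <- l) x).+1) :: l, X ++ Y) => //.
  exists (maxn N (\sum_(x <- l) x).+1) => //; split=> /=.
  - by move=> x xl; rewrite leq_max ltnS (big_rem x xl) /= leq_addr orbT.
  - by move=> z zX; rewrite mem_cat zX.
  - by apply: NP; rewrite leq_maxl.
  - move=> i j cij; have [il jl _ _] := cij.
    have [|x [y jn]] := YP (i, j) _ cij; first by apply/allpairsP; exists (i, j).
    exists x, y; apply: joined_mono jn => z [zY zX zl]; split=> //; by rewrite mem_cat zY orbT.
have [|st [st0 _ stS]] := @dependent_choice_inv _ (fun=> True) Rel ([::], [::]) I.
  by move=> a _; exact: step.
pose l n := (st n).1; pose X n := (st n).2.
pose g n := head 0 (l n.+1).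
have lE n : [/\ l n.+1 = g n :: l n, forall x, x \in l n -> x < g n, {subset X n <= X n.+1},
    forall z, z \in X n.+1 -> ~ on C (g n) z
    & forall i j, consecutive (l n) i j -> rung (l n) (X n) (X n.+1) i j].
  by rewrite /g; have [w E [? ? ? ?]] := stS n; rewrite /l E /=; split.
have memP n x : x \in l n <-> exists2 c, c < n & x = g c.
  elim: n => [|n IH]; first by rewrite /l st0; split=> // -[].
  have [-> _ _ _ _] := lE n; rewrite inE; split=> [/orP[/eqP->|/IH[c cn ->]]|[c]]; first by exists n.
    by exists c => //; apply: ltnW.
  rewrite ltnS leq_eqVlt => /orP[/eqP-> ->|cn xE]; first by rewrite eqxx.
  by apply/orP; right; apply/IH; exists c.
have gm : {homo g : m n / m < n} by move=> m n mn; have [_ H _ _ _] := lE n; apply: H; apply/memP; exists m.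
have ginj : injective g by move=> m n; case: (ltngtP m n) => // /gm + E; rewrite E ltnn.
have gle m n : m <= n -> g m <= g n by rewrite leq_eqVlt => /orP[/eqP->//|/gm/ltnW].
have Xsub n : {subset X n <= X n.+1} by case: (lE n).
have Xm m n : m <= n -> {subset X m <= X n}.
  by move/subnKC <-; elim: (n - m) => [|k IH] z; rewrite ?addn0 ?addnS // => /IH/Xsub.
exists (fun n => C (g n)); first exact: rays_reindex ginj HR.
(* The link made at stage [n] is new, so it avoids [X0]. It avoids the other rays below index [n] by
   construction, and those from [n] on because they miss [X n.+1]. *)
move=> r X0; have [N NP] := eventually_avoid X0 Xsub.
pose n := maxn N r.+2; have rn : r.+1 < n by exact: leq_maxr.
have [_ _ _ _ /(_ (g r) (g r.+1))[]] := lE n.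
  split; first by apply/memP; exists r => //; apply: ltnW.
  - by apply/memP; exists r.+1.
  - exact: gm.
  - move=> s /memP[c cn ->]; case: (leqP c r) => cr; [left|right]; exact: gle.
move=> a [b jn]; exists a, b; apply: joined_mono jn => z [zX' zX zl]; split.
  by apply: contraNN zX => z0; apply: NP z0 zX'; exact: leq_maxl.
move=> s c [sr sr'] zc; have oz : on C (g s) z by exists c.
case: (ltnP s n) => sn.
  by apply: (zl (g s)) oz; rewrite ?(inj_eq ginj) //; apply/memP; exists s.
have [_ _ _ /(_ z) H _] := lE s; apply: H oz; exact: Xm zX'.
Qed.

(** [h] cuts all rays at common heights, so that later links attach higher. [p t] lists only the
    inner vertices of link [t], which are off all rays. *)
Lemma timed_links (Q : nat -> nat -> V) (rho : nat -> nat) : equivalent_rays e Q -> ladder Q ->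
  exists h a b : nat -> nat, exists p : nat -> seq V,
    (forall t, [/\ h t <= a t < h t.+1, h t <= b t < h t.+1,
       path e (Q (rho t) (a t)) (p t), e (last (Q (rho t) (a t)) (p t)) (Q (rho t).+1 (b t))
       & forall z c, z \in p t -> ~ on Q c z]) /\
    (forall s t z, s != t -> z \in p s -> z \notin p t).
Proof.
move=> HQ lad.
have step t h (X : seq V) : exists a b p, [/\ h <= a, h <= b, path e (Q (rho t) a) p,
    e (last (Q (rho t) a) p) (Q (rho t).+1 b) & forall z, z \in p -> z \notin X /\ forall c, ~ on Q c z].
  set r := rho t.
  (* Forbidding the first [h] vertices of both rays puts the attachments at height [h] or above. *)
  have [x [y jn]] := lad r (X ++ mkseq (Q r) h ++ mkseq (Q r.+1) h).
  have [||_ [_ [a [b [-> -> [p [pp lp Pp [nI nJ]]]]]]]] :=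
    @trim_linked _ _ Q (fun s => s = r) (fun s => s = r.+1) _ _ _ jn.
  - by exists r => //; exists x.
  - by exists r.+1 => //; exists y.
  have far c d : Q c d \notin mkseq (Q c) h -> h <= d.
    rewrite leqNgt; apply: contraNN => dh; apply/mapP; exists d => //; by rewrite mem_iota.
  case/lastP: p pp lp Pp nI nJ => [_ /= /(rays_inj HQ)[E] _|p l].
    by case: (n_Sn _ E).
  rewrite rcons_path last_rcons => /andP[pp el] lE Pp nI nJ; rewrite lE in el Pp nI nJ.
  exists a, b, p; split=> //.
  - by have [] := Pp _ (mem_head _ _); rewrite !mem_cat !negb_or => /and3P[_ /far].
  - have [] := Pp (Q r.+1 b); first by rewrite inE mem_rcons mem_head orbT.
    by rewrite !mem_cat !negb_or => /and3P[_ _ /far].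
  - move=> z zp; have [] := Pp z; first by rewrite inE mem_rcons inE zp !orbT.
    rewrite !mem_cat !negb_or => /andP[zX _] zF; split=> // c [d zd].
    case: (eqVneq c r) => [cr|cr].
      by apply: (nI z c _ cr); [rewrite mem_rcons inE zp orbT|exists d].
    case: (eqVneq c r.+1) => [cr'|cr'].
      by apply: (nJ z c _ cr'); [rewrite belast_rcons inE zp orbT|exists d].
    by apply: (zF c d).
pose St := (nat * nat * seq V * (nat * nat * seq V))%type.
pose Rel (s s' : St) := let: (t, h, X, _) := s in let: (t', h', X', (a, b, p)) := s' in
  [/\ t' = t.+1, X' = X ++ p, h <= a < h', h <= b < h' &
   [/\ path e (Q (rho t) a) p, e (last (Q (rho t) a) p) (Q (rho t).+1 b)
     & forall z, z \in p -> z \notin X /\ forall c, ~ on Q c z]].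
have [|st [st0 _ stS]] := @dependent_choice_inv _ (fun=> True) Rel (0, 0, [::], (0, 0, [::])) I.
  case=> [[[t h] X] d0] _; have [a [b [p [ha hb pp el Pp]]]] := step t h X.
  exists (t.+1, (maxn a b).+1, X ++ p, (a, b, p)) => //.
  by split; rewrite // ?ha ?hb /= ltnS ?leq_maxl ?leq_maxr.
pose h t := (st t).1.1.2; pose X t := (st t).1.2; pose d t := (st t.+1).2.
have tE t : (st t).1.1.1 = t.
  elim: t => [|t IH]; first by rewrite st0.
  have := stS t; move: IH; case: (st t) => [[[t0 h0] X0] d0]; case: (st t.+1) => [[[t1 h1] X1] [[a b] p]] /=.
  by move=> -> [].
have dP t : [/\ X t.+1 = X t ++ (d t).2, h t <= (d t).1.1 < h t.+1, h t <= (d t).1.2 < h t.+1 &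
   [/\ path e (Q (rho t) (d t).1.1) (d t).2, e (last (Q (rho t) (d t).1.1) (d t).2) (Q (rho t).+1 (d t).1.2)
     & forall z, z \in (d t).2 -> z \notin X t /\ forall c, ~ on Q c z]].
  have := stS t; have := tE t; rewrite /X /h /d.
  case: (st t) => [[[t0 h0] X0] d0]; case: (st t.+1) => [[[t1 h1] X1] [[a b] p]] /=.
  by move=> -> [].
exists h, (fun t => (d t).1.1), (fun t => (d t).1.2), (fun t => (d t).2); split.
  by move=> t; have [_ ? ? [? ? H]] := dP t; split=> // z c /H[].
have Xm m n : m <= n -> {subset X m <= X n}.
  move/subnKC <-; elim: (n - m) => [|k IH] z; rewrite ?addn0 ?addnS // => /IH zX.
  by have [-> _ _ _] := dP (m + k); rewrite mem_cat zX.
have dis s t z : s < t -> z \in (d s).2 -> z \notin (d t).2.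
  move=> st' zs; apply/negP => zt; have [_ _ _ [_ _ /(_ z zt)[/negP + _]]] := dP t; apply.
  by apply: (Xm s.+1 t st'); have [-> _ _ _] := dP s; rewrite mem_cat zs orbT.
move=> s t z; rewrite neq_ltn => /orP[/dis H|/dis H zs]; first exact: H.
by apply/negP => /H; rewrite zs.
Qed.

End Ladder.

(** * Half grid and quadrant *)

Section MinorIn.

Definition minor_in (G H : graph) (A : set H) : Prop :=
  exists B : G -> set H,
    [/\ forall x, connected_set (B x), trivIset [set: G] B,
        forall x y, adj x y -> exists u v, [/\ B x u, B y v & adj u v]
      & forall x, B x `<=` A].

Lemma minor_inT (G H : graph) : minor G H <-> minor_in G [set: H].
Proof. by split=> [[B [? ? ?]]|[B [? ? ? _]]]; exists B; split. Qed.

Lemma connected_bigcup (H K : graph) (B : H -> set K) (A : set H) :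
  (forall y, connected_set (B y)) ->
  (forall x y, adj x y -> exists u v, [/\ B x u, B y v & adj u v]) ->
  connected_set A -> connected_set (\bigcup_(y in A) B y).
Proof.
move=> cB eB [[a0 Aa0] cA]; set U := \bigcup_(y in A) B y.
have inB y u v : A y -> B y u -> B y v ->
    clos_refl_trans K (fun u v => [/\ U u, U v & adj u v]) u v.
  move=> Ay yu yv; elim: ((cB y).2 u v yu yv) => {u v yu yv} [u v [yu yv uv]|u|u w v _ IH1 _ IH2].
  - by apply: rt_step; split=> //; exists y.
  - exact: rt_refl.
  - exact: rt_trans IH1 IH2.
split; first by have [u yu] := (cB a0).1; exists u, a0.
move=> u v [y Ay yu] [y' Ay' yv'].
suff [_ join] : A y' /\ forall u v, B y u -> B y' v ->
    clos_refl_trans K (fun u v => [/\ U u, U v & adj u v]) u v by exact: join.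
have yy' := cA y y' Ay Ay'; elim: yy' Ay {u v yu yv' Ay'} => {y y'} [y y' [_ Ay' yy']|y|y z y' _ IH1 _ IH2] Ay.
- split=> // u v yu yv; have [u' [v' [yu' yv' uv']]] := eB _ _ yy'.
  apply: (rt_trans _ _ _ u'); first exact: inB yu yu'.
  apply: (rt_trans _ _ _ v'); last exact: inB yv' yv.
  by apply: rt_step; split=> //; [exists y|exists y'].
- by split=> // u v; exact: inB.
- have [Az H1] := IH1 Ay; have [Ay' H2] := IH2 Az; split=> // u v yu yv.
  by have [w zw] := (cB z).1; apply: (rt_trans _ _ _ w); [exact: H1|exact: H2].
Qed.

Lemma minor_in_comp (G H K : graph) (A : set H) (B : H -> set K) (C : set K) :
  minor_in G A ->
  (forall y, connected_set (B y)) -> trivIset [set: H] B ->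
  (forall x y, adj x y -> exists u v, [/\ B x u, B y v & adj u v]) ->
  (forall y, A y -> B y `<=` C) -> minor_in G C.
Proof.
move=> [B1 [cB1 tB1 eB1 sB1]] cB tB eB sB.
exists (fun x => \bigcup_(y in B1 x) B y); split.
- by move=> x; apply: connected_bigcup.
- move=> x x' _ _ [u [[y xy yu] [y' xy' yu']]].
  have E : y = y' by apply: tB => //; exists u.
  by apply: tB1 => //; exists y; split=> //; rewrite E.
- move=> x x' /eB1[y [y' [xy xy' /eB[u [v [yu yv uv]]]]]].
  by exists u, v; split=> //; [exists y|exists y'].
- by move=> x u [y /sB1 Ay yu]; exact: sB Ay u yu.
Qed.

Lemma minor_in_trans (G H K : graph) (C : set K) :
  minor G H -> minor_in H C -> minor_in G C.
Proof.
move=> /minor_inT GH [B [cB tB eB sB]]; apply: minor_in_comp GH cB tB eB _ => y _; exact: sB.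
Qed.

Lemma connected_set1 (G : graph) (x : G) : connected_set [set x].
Proof. by split=> [|_ _ -> ->]; [exists x|exact: rt_refl]. Qed.

End MinorIn.

Definition quadrant_adj (p q : nat * nat) :=
  (p.1 = q.1 /\ (q.2 = p.2.+1 \/ p.2 = q.2.+1)) \/ (p.2 = q.2 /\ (q.1 = p.1.+1 \/ p.1 = q.1.+1)).

Lemma quadrant_adj_sym p q : quadrant_adj p q -> quadrant_adj q p.
Proof. by case=> -[E [F|F]]; [left|left|right|right]; split; auto. Qed.

Lemma quadrant_adj_irrefl p : ~ quadrant_adj p p.
Proof. by case=> -[_ []] /n_Sn. Qed.

Definition quadrant : graph := Graph quadrant_adj_sym quadrant_adj_irrefl.

Section HalfGridInQuadrant.

(** For [p = (n, z)] the corner lies on the diagonal [x - y = 2z + 1] and moves by [(2, 2)] as [n]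
    grows. Negative stairs start at [x = 1] like the stair [z = 0], so that stairs [-1] and [0]
    touch as two negative neighbours do. *)
Definition corner (p : nat * int) : nat * nat :=
  match p.2 with
  | Posz c => (2 * c + 2 * p.1 + 1, 2 * p.1)
  | Negz c => (2 * p.1 + 1, 2 * c + 2 + 2 * p.1)
  end.

(* Going up the diagonals, the staircase [x - y \in {2z, 2z + 1}] is cut into pieces of four vertices. *)
Definition stair (p : nat * int) : set quadrant := fun q =>
  let: (X, Y) := corner p in
  [\/ q = (X, Y), q = (X, Y.+1), q = (X.+1, Y.+1) | q = (X.+1, Y.+2)].

Lemma stair_connected p : connected_set (stair p : set quadrant).
Proof.
rewrite /stair; case: (corner p) => X Y; set S := (S in connected_set S).
have ad (q q' : quadrant) : S q -> S q' -> quadrant_adj q q' ->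
    clos_refl_trans quadrant (fun u v => [/\ S u, S v & adj u v]) q q'.
  by move=> Sq Sq' qq; apply: rt_step; split.
have S1 : S (X, Y) by constructor 1.
have S2 : S (X, Y.+1) by constructor 2.
have S3 : S (X.+1, Y.+1) by constructor 3.
have S4 : S (X.+1, Y.+2) by constructor 4.
have e12 : quadrant_adj (X, Y) (X, Y.+1) by left; split; [|left].
have e23 : quadrant_adj (X, Y.+1) (X.+1, Y.+1) by right; split; [|left].
have e34 : quadrant_adj (X.+1, Y.+1) (X.+1, Y.+2) by left; split; [|left].
have from1 q : S q -> clos_refl_trans quadrant (fun u v => [/\ S u, S v & adj u v]) (X, Y) q /\
    clos_refl_trans quadrant (fun u v => [/\ S u, S v & adj u v]) q (X, Y).
  have j12 := ad _ _ S1 S2 e12; have j21 := ad _ _ S2 S1 (quadrant_adj_sym e12).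
  have j23 := ad _ _ S2 S3 e23; have j32 := ad _ _ S3 S2 (quadrant_adj_sym e23).
  have j34 := ad _ _ S3 S4 e34; have j43 := ad _ _ S4 S3 (quadrant_adj_sym e34).
  case=> ->; split; try exact: rt_refl; try by [].
  - exact: rt_trans j12 j23.
  - exact: rt_trans j32 j21.
  - exact: rt_trans j12 (rt_trans _ _ _ _ _ j23 j34).
  - exact: rt_trans j43 (rt_trans _ _ _ _ _ j32 j21).
split; first by exists (X, Y).
move=> q q' /from1[_ h1] /from1[h2 _]; exact: rt_trans h1 h2.
Qed.

Lemma stair_bounds p x y : stair p (x, y) ->
  (corner p).1 <= x <= (corner p).1.+1 /\ x + (corner p).2 <= y + (corner p).1 <= (x + (corner p).2).+1.
Proof. by rewrite /stair; case: (corner p) => X Y /= [] [-> ->]; lia. Qed.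

Lemma stair_inj p q r : stair p r -> stair q r -> p = q.
Proof.
case: p q r => [n z] [m z'] [x y] /stair_bounds + /stair_bounds.
case: z => c; case: z' => d; rewrite /corner /= => h1 h2.
- by have [-> ->] : n = m /\ c = d by lia.
- by suff: false by []; lia.
- by suff: false by []; lia.
- by have [-> ->] : n = m /\ c = d by lia.
Qed.

Lemma stair_up n z : exists u v, [/\ stair (n, z) u, stair (n.+1, z) v & @adj quadrant u v].
Proof.
exists ((corner (n, z)).1.+1, (corner (n, z)).2.+2), ((corner (n, z)).1.+2, (corner (n, z)).2.+2).
split; first by rewrite /stair; case: (corner _) => X Y; constructor 4.
  rewrite /stair; have -> : corner (n.+1, z) = ((corner (n, z)).1.+2, (corner (n, z)).2.+2).
    by case: z => c; rewrite /corner /=; congr pair; lia.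
  by constructor 1.
by right; split; [|left].
Qed.

Lemma stair_right n (z z' : int) : z' = (z + 1)%R ->
  exists u v, [/\ stair (n, z) u, stair (n, z') v & @adj quadrant u v].
Proof.
case: z => [c|c] zE.
  have -> : z' = Posz c.+1 by lia.
  exists (2 * c + 2 * n + 2, (2 * n).+1), (2 * c + 2 * n + 3, (2 * n).+1); split.
  - by rewrite /stair /corner /=; constructor 3; congr pair; lia.
  - by rewrite /stair /corner /=; constructor 2; congr pair; lia.
  - by right; split=> //=; left; lia.
have : exists X Y, corner (n, Negz c) = (X, Y.+2) /\ corner (n, z') = (X, Y).
  case: c zE => [|c] zE.
    have -> : z' = Posz 0 by lia.
    by exists (2 * n + 1), (2 * n); split; rewrite /corner /=; congr pair; lia.
  have -> : z' = Negz c by lia.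
  by exists (2 * n + 1), (2 * c + 2 + 2 * n); split; rewrite /corner /=; congr pair; lia.
case=> X [Y [E1 E2]]; exists (X, Y.+2), (X.+1, Y.+2); rewrite /stair E1 E2; split.
- by constructor 1.
- by constructor 4.
- by right; split=> //; left.
Qed.

Lemma half_grid_minor_quadrant : minor half_grid quadrant.
Proof.
exists stair; split; first exact: stair_connected.
  by move=> p q _ _ [r [pr qr]]; exact: stair_inj pr qr.
have flip (p q : nat * int) : (exists u v, [/\ stair p u, stair q v & @adj quadrant u v]) ->
    exists u v, [/\ stair q u, stair p v & @adj quadrant u v].
  by move=> [u [v [pu qv uv]]]; exists v, u; split=> //; exact: adj_sym.
move=> [n z] [m z'] [[/= <- d]|[/= <- d]].
  have [E|E] : z' = (z + 1)%R \/ z = (z' + 1)%R by lia.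
    exact: stair_right.
  exact/flip/stair_right.
have [->|->] : m = n.+1 \/ n = m.+1 by lia.
  exact: stair_up.
exact/flip/stair_up.
Qed.

End HalfGridInQuadrant.

Lemma quadrant_minor_half (b : bool) :
  minor_in quadrant ([set p : nat * int | (0 <= p.2)%R = b] : set half_grid).
Proof.
pose f (p : nat * nat) : nat * int := (p.2, if b then Posz p.1 else Negz p.1).
exists (fun p => [set f p] : set half_grid); split.
- by move=> p; exact: connected_set1.
- by move=> [r m] [r' m'] _ _ [q [-> /=]]; rewrite /f; clear f; case: b => -[-> ->].
- move=> p q pq; exists (f p), (f q); split=> //.
  case: p q pq => [r m] [r' m'] [[/= -> E]|[/= -> E]]; [right|left]; split=> //=.
    by case: E => ->; lia.
  by clear f; case: b => /=; case: E => ->; lia.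
- by move=> [r m] _ ->; rewrite /f /=; clear f; case: b.
Qed.

Lemma quadrant_split (K : graph) (A : set K) : minor_in quadrant A ->
  exists A1 A2, [/\ A1 `<=` A, A2 `<=` A `\` A1, minor_in quadrant A1 & minor_in quadrant A2].
Proof.
move=> /(minor_in_trans half_grid_minor_quadrant) [B [cB tB eB sB]].
pose part b := \bigcup_(p in [set p : half_grid | (0 <= p.2)%R = b]) B p.
have sub b : minor_in quadrant (part b).
  apply: minor_in_comp (quadrant_minor_half b) cB tB eB _ => p pb u pu; by exists p.
exists (part true), (part false); split=> //.
  by move=> u [p _ /sB].
move=> u [p pf pu]; split; first exact: sB pu.
move=> [q qt qu]; have E : p = q by apply: tB => //; exists u.
by move: pf qt; rewrite /= E => ->.
Qed.

(** * The main theorem *)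

Section Schedule.

(* The link between columns [r] and [r + 1] in row [m] is made at time [time r m]; the
   times with [r + 2m = w] fill part of the interval from [w ^ 2] to [(w + 1) ^ 2]. *)
Definition time r m := (r + 2 * m) * (r + 2 * m) + r.

(** Recovers [r] from [time r m]: since [r] is at most [r + 2m], the square root is [r + 2m] and [r]
    is the excess over its square. *)
Definition column t := t - Nat.sqrt t * Nat.sqrt t.

Lemma time_sqrt r m : Nat.sqrt (time r m) = r + 2 * m.
Proof. by apply: PeanoNat.Nat.sqrt_unique; rewrite /time; nia. Qed.

Lemma columnK r m : column (time r m) = r.
Proof. by rewrite /column time_sqrt /time; lia. Qed.

Lemma time_inj r m r' m' : time r m = time r' m' -> r = r' /\ m = m'.
Proof.
move=> E; have rE : r = r' by rewrite -(columnK r m) E columnK.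
by split=> //; have := time_sqrt r m; rewrite E time_sqrt rE; lia.
Qed.

End Schedule.

(** * From a ladder to the quadrant *)

Section RaysToQuadrant.
Variable K : graph.
Let V : eqType := {classic K}.
Definition adjb : rel V := fun x y => `[< @adj K x y >].

Lemma adjb_sym : symmetric adjb.
Proof. by move=> x y; apply/asboolP/asboolP => /adj_sym. Qed.

Lemma joined_clos (A : set V) x y : joined adjb A x y ->
  clos_refl_trans K (fun u v => [/\ A u, A v & adj u v]) x y.
Proof.
case=> p [pp <- Ap]; elim: p x pp Ap => [|z p IH] x /=; first by move=> _ _; exact: rt_refl.
move=> /andP[/asboolP xz pp] Ap.
have Azp v : v \in z :: p -> A v by move=> vp; apply: Ap; rewrite inE vp orbT.
apply: rt_trans (IH z pp Azp); apply: rt_step; split=> //; first exact/Ap/mem_head.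
exact/Azp/mem_head.
Qed.

Lemma clos_joined (A : set V) x y : A x ->
  clos_refl_trans K (fun u v => [/\ A u, A v & adj u v]) x y -> joined adjb A x y.
Proof.
move=> Ax xy; elim: xy Ax => {x y} [x y [Ax Ay xy] _|x Ax|x y z _ IH1 _ IH2 Ax].
- by apply: joined_edge => //; apply/asboolP.
- exact: joined_refl.
- by have j := IH1 Ax; apply: joined_trans j (IH2 (joined_right j)).
Qed.

Lemma quadrant_of_ladder Q : equivalent_rays adjb Q -> ladder adjb Q -> minor quadrant K.
Proof.
move=> HQ lad; have [h [a [b [p [lk dis]]]]] := timed_links column HQ lad.
have h_lt : {homo h : m n / m < n}.
  apply: homo_ltn; first exact: ltn_trans.
  by move=> n; have [/andP[h1 h2] _ _ _ _] := lk n; exact: leq_ltn_trans h1 h2.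
have h_le m n : m <= n -> h m <= h n by rewrite leq_eqVlt => /orP[/eqP->//|/h_lt/ltnW].
(* A branch set takes its ray from time [(w - 1) ^ 2] to [(w + 1) ^ 2]. [w] grows by 2 with the row,
   so these windows abut on each ray. It grows by 1 with the column, so the next column's window
   starts at [w ^ 2], and the link at time [w ^ 2 + r] attaches inside both. For [w = 0] truncation
   starts the window at [h 0]. *)
pose w (q : nat * nat) := q.1 + 2 * q.2.
pose lo q := h ((w q).-1 * (w q).-1).
pose hi q := h ((w q).+1 * (w q).+1).
pose B (q : nat * nat) : set V := fun z =>
  (exists2 x, lo q <= x < hi q & z = Q q.1 x) \/ z \in p (time q.1 q.2).
have tlo r m : (w (r, m)).-1 * (w (r, m)).-1 <= w (r, m) * w (r, m) <= time r m.
  by rewrite /w /time /=; nia.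
have thi r m : time r m < (w (r, m)).+1 * (w (r, m)).+1.
  by rewrite /w /time /=; nia.
have a_in r m : lo (r, m) <= a (time r m) < hi (r, m).
  have [/andP[h1 h2] _ _ _ _] := lk (time r m); have /andP[t1 t2] := tlo r m.
  by rewrite (leq_trans (h_le _ _ (leq_trans t1 t2)) h1) (leq_trans h2 (h_le _ _ (thi r m))).
have b_in r m : lo (r.+1, m) <= b (time r m) < hi (r.+1, m).
  have [_ /andP[h1 h2] _ _ _] := lk (time r m); have /andP[t1 t2] := tlo r m.
  have wE : w (r.+1, m) = (w (r, m)).+1 by [].
  rewrite /lo /hi wE /= (leq_trans (h_le _ _ t2) h1) /=.
  by rewrite (leq_trans h2) // h_le // (leq_trans (thi r m)) // leq_mul.
exists B; split.
- move=> [r m]; set S := B (r, m).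
  have col x : lo (r, m) <= x < hi (r, m) -> joined adjb S (Q r (a (time r m))) (Q r x).
    move=> /andP[lx xh]; have /andP[la ah] := a_in r m.
    case/orP: (leq_total (a (time r m)) x) => ax; last apply: (joined_sym adjb_sym);
      apply: (ray_joined_le HQ) => // k /andP[k1 k2]; left; exists k => //; apply/andP; split.
    + exact: leq_trans la k1.
    + exact: leq_ltn_trans k2 xh.
    + exact: leq_trans lx k1.
    + exact: leq_ltn_trans k2 ah.
  have root z : S z -> joined adjb S (Q r (a (time r m))) z.
    case=> [[x xl ->]|zp]; first exact: col.
    have [_ _ pp _ _] := lk (time r m); rewrite columnK in pp.
    apply: (path_joined pp); last by rewrite inE zp orbT.
    move=> u; rewrite inE => /orP[/eqP->|up]; last by right.
    by left; exists (a (time r m)).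
  split; first by exists (Q r (a (time r m))); left; exists (a (time r m)).
  move=> x y /root jx /root jy; apply: joined_clos.
  exact: joined_trans (joined_sym adjb_sym jx) jy.
- move=> [r m] [r' m'] _ _ [z [/= Bz Bz']].
  have off t c x : z \in p t -> z <> Q c x.
    by move=> zp zQ; have [_ _ _ _ /(_ z c zp)] := lk t; apply; exists x.
  case: Bz Bz' => [[x /andP[x1 x2] zx]|zp] [[x' /andP[x1' x2'] zx']|zp'] /=.
  + move: zx; rewrite zx' => /(rays_inj HQ)[/= rE xE]; move: x1 x2 x1' x2'; rewrite rE xE.
    have key n n' : n < n' -> lo (r, n') <= x -> x < hi (r, n) -> False.
      move=> nn l1 l2; have := leq_ltn_trans l1 l2; rewrite ltnNge => /negP; apply.
      by apply: h_le; apply: leq_mul; rewrite /w /=; lia.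
    case: (ltngtP m m') => [mm|mm|->] // x1 x2 x1' x2'.
      by case: (key m m' mm).
    by case: (key m' m mm).
  + by case: (off _ _ _ zp' zx).
  + by case: (off _ _ _ zp zx').
  + have [/time_inj[/= -> ->] //|ne] := eqVneq (time r m) (time r' m').
    by have := dis _ _ z ne zp; rewrite zp'.
- have flip (q q' : nat * nat) : (exists u v, [/\ B q u, B q' v & @adj K u v]) ->
      exists u v, [/\ B q' u, B q v & @adj K u v].
    by move=> [u [v [qu qv uv]]]; exists v, u; split=> //; exact: adj_sym.
  have up r m : exists u v, [/\ B (r, m) u, B (r, m.+1) v & @adj K u v].
    have hw : lo (r, m.+1) = hi (r, m) by rewrite /lo /hi /w /=; congr (h (_ * _)); lia.
    have lh q : lo q < hi q by apply: h_lt; rewrite /w; nia.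
    exists (Q r (hi (r, m)).-1), (Q r (hi (r, m))).
    have h0 : 0 < hi (r, m) by apply: leq_ltn_trans (lh (r, m)).
    split.
    + left; exists (hi (r, m)).-1 => //.
      by rewrite ltn_predL h0 andbT -ltnS prednK.
    + by left; exists (hi (r, m)) => //; rewrite -hw leqnn lh.
    + by have /asboolP := rays_edge HQ r (hi (r, m)).-1; rewrite prednK.
  have right r m : exists u v, [/\ B (r, m) u, B (r.+1, m) v & @adj K u v].
    have [_ _ _ + _] := lk (time r m); rewrite columnK => /asboolP el.
    exists (last (Q r (a (time r m))) (p (time r m))), (Q r.+1 (b (time r m))); split=> //.
      have := mem_last (Q r (a (time r m))) (p (time r m)); rewrite inE => /orP[/eqP->|]; last by right.
      by left; exists (a (time r m)).
    by left; exists (b (time r m)).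
  move=> [r m] [r' m'] [[/= <- [->|->]]|[/= <- [->|->]]].
  + exact: up.
  + exact/flip/up.
  + exact: right.
  + exact/flip/right.
Qed.

End RaysToQuadrant.

(** * Disjoint models of the connected graph *)

Section Ubiquity.
Variables (G Gamma : graph).

Definition has_model (M : set Gamma) := connected_set M /\ minor_in G M.

Lemma copies_of_disjoint_models (I : Type) (M : I -> set Gamma) :
  (forall i, minor_in G (M i)) -> (forall i j, i <> j -> M i `&` M j = set0) ->
  minor (copies I G) Gamma.
Proof.
move=> hM dM; have [B BP] := choice hM.
exists (fun p => B p.1 p.2); split.
- by move=> [i x] /=; case: (BP i).
- move=> [i x] [j y] _ _ [z [/= ix jy]].
  have [_ _ _ si] := BP i; have [_ _ _ sj] := BP j.
  case: (pselect (i = j)) => [ij|/dM]; last first.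
    by rewrite -subset0 => /(_ z)[]; split; [exact: si ix|exact: sj jy].
  rewrite -ij in jy *; congr pair; have [_ tB _ _] := BP i; apply: tB => //.
  by exists z.
- move=> [i x] [j y] [/= <- xy]; have [_ _ eB _] := BP i.
  exact: eB.
Qed.

(** Here the connectedness of [G] enters: it makes the union of the branch sets of one copy
    connected, hence a member. *)
Lemma thick_of_copies : connected_graph G -> (forall n, minor (copies 'I_n G) Gamma) ->
  thick (V := {classic Gamma}) has_model setT.
Proof.
move=> cG nG n; have [B [cB tB eB]] := nG n.
pose M (i : nat) : set Gamma := fun z => exists j : 'I_n, i = j /\ exists x, B (j, x) z.
have BE (j : 'I_n) : M j = \bigcup_(x in [set: G]) B (j, x).
  apply/seteqP; split=> z; first by case=> j' [jj [x xz]]; exists x => //; rewrite (ord_inj jj).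
  by case=> x _ xz; exists j; split=> //; exists x.
exists M; split.
- move=> i ni; split=> //; have -> : i = Ordinal ni by [].
  have edge x y : adj x y -> exists u v, [/\ B (Ordinal ni, x) u, B (Ordinal ni, y) v & adj u v].
    by move=> xy; apply: eB.
  split; first by rewrite BE; apply: connected_bigcup.
  exists (fun x => B (Ordinal ni, x)); split=> //.
    by move=> x y _ _ [z [xz yz]]; have [] : (Ordinal ni, x) = (Ordinal ni, y) by apply: tB => //; exists z.
  by move=> x z xz; rewrite BE; exists x.
- move=> i j _ _ ij; rewrite -subset0 => z [[i' [iE [x xz]]] [j' [jE [y yz]]]].
  have [E _] : (i', x) = (j', y) by apply: tB => //; exists z.
  by move: ij; rewrite iE jE E eqxx.
Qed.

Lemma copies_of_quadrant : minor G half_grid -> minor quadrant Gamma -> minor (copies nat G) Gamma.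
Proof.
move=> GH /minor_inT HG.
have [|M [MG dM]] := @peel {classic Gamma} (fun A => minor_in G (A : set Gamma)) (fun A => minor_in quadrant (A : set Gamma)) _ HG.
  move=> A /quadrant_split[A1 [A2 [A1A A2A q1 q2]]]; exists A1, A2; split=> //.
  apply: minor_in_trans (minor_in_trans half_grid_minor_quadrant q1).
  exact: GH.
by apply: copies_of_disjoint_models MG _ => i j /eqP; exact: dM.
Qed.

End Ubiquity.

Theorem theorem1p4 (G : graph) (hconn : connected_graph G)
  (hminor : minor G half_grid) : ubiquitous G.
Proof.
move=> Gamma nG.
have [|M x y [[_ cM] _] Mx My|[M [MG dM]]|[R HR]] :=
    @thick_rays {classic Gamma} (@adjb Gamma) (@adjb_sym Gamma) (@has_model G Gamma) _ _ (thick_of_copies hconn nG).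
- by move=> M [[]].
- by apply: clos_joined => //; exact: cM.
- by apply: copies_of_disjoint_models (fun i => (MG i).2) _ => i j /eqP; exact: dM.
have [Q HQ lad] := ladder_exists (@adjb_sym Gamma) HR.
exact: copies_of_quadrant hminor (quadrant_of_ladder HQ lad).
Qed.
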